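(* Let $K$ be a field of characteristic zero and $n\ge 2$. Let $\delta:F_n\to (KU_n)\,\mathrm{wr}\,(KV_n)$ be the embedding of the free metabelian Lie algebra $F_n$ into the abelian wreath product. The Lie algebra $F_n^{S_n}$ of symmetric polynomials in $F_n$ is generated by \[ f_1(X_n)=x_1+\cdots+x_n\in F_n \] together with the elements of $F_n$ whose images under $\delta$ are \[ h_{ij}(U_n,X_n)\,e_2^{a_2}(X_n)\cdots e_n^{a_n}(X_n),\qquad 1\le i<j\le n,\quad a_2,\dots,a_n\ge 0, \] where \[ h_{ij}(U_n,X_n)=j\,\varepsilon_i(U_n,X_n)\,e_j(X_n)-i\,\varepsilon_j(U_n,X_n)\,e_i(X_n). \]
   Context: $K$ is a field of characteristic zero, $n\ge 2$, $X_n=\{x_1,\dots,x_n\}$, and $K[X_n]$ is the commutative polynomial algebra. $F_n=L_n/L_n''$ is the free metabelian Lie algebra over $K$ freely generated by $X_n$, where $L_n$ is the free Lie algebra on $X_n$ and $L_n''=[[L_n,L_n],[L_n,L_n]]$. Abelian wreath product: let $KU_n$ and $KV_n$ be abelian Lie algebras with bases $U_n=\{u_1,\dots,u_n\}$ and $V_n=\{v_1,\dots,v_n\}$, and let $W_n$ be the free right $K[X_n]$-module with free generators $u_1,\dots,u_n$. As a vector space $(KU_n)\,\mathrm{wr}\,(KV_n)=W_n\oplus KV_n$, with Lie bracket determined by $[W_n,W_n]=0$, $[V_n,V_n]=0$, $[u_ip(X_n),v_j]=u_ip(X_n)x_j$ for $p\in K[X_n]$. The Lie algebra homomorphism $\delta:F_n\to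 (KU_n)\,\mathrm{wr}\,(KV_n)$ defined by $\delta(x_i)=u_i+v_i$ is injective and maps $F_n'=[F_n,F_n]$ into $W_n$; an element $\sum_i u_ip_i(X_n)\in W_n$ lies in $\delta(F_n')$ if and only if $\sum_i x_ip_i(X_n)=0$. The symmetric group $S_n$ acts on $F_n$ by Lie algebra automorphisms with $\sigma(x_i)=x_{\sigma(i)}$, and $F_n^{S_n}$ is the Lie subalgebra of invariants. Elements of $W_n$ are written as polynomials in the commuting variables $U_n\cup X_n$ which are linear homogeneous in $U_n$. For $1\le q\le n$, $e_q(X_n)=\sum_{1\le j_1<\cdots<j_q\le n}x_{j_1}\cdots x_{j_q}$ is the $q$-th elementary symmetric polynomial. For $0\le q\le n-1$, \[ \varepsilon_{q+1}(U_n,X_n)=\sum_{i=1}^n u_i\sum x_{j_1}\cdots x_{j_q}, \] where the inner sum runs over all $1\le j_1<\cdots<j_q\le n$ with $i\ne j_1,\dots,j_q$ (so $\varepsilon_1=u_1+\cdots+u_n$). *)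

(* Defs.v *)
From HB Require Import structures.
From mathcomp Require Import all_boot all_order all_algebra perm.
From mathcomp Require Import boolp classical_sets.
From mathcomp Require Import mpoly.

Set Implicit Arguments.
Unset Strict Implicit.
Unset Printing Implicit Defensive.

Import GRing.Theory.

Local Open Scope ring_scope.
Local Open Scope classical_set_scope.
Local Open Scope quotient_scope.

Reserved Notation "[< x , y >]" (at level 0, format "[< x ,  y >]").
Reserved Notation "w *r p" (at level 40, left associativity).

HB.mixin Record Lmodule_isLieAlgebra (K : comNzRingType) V
    of GRing.Lmodule K V := {
  lie : V -> V -> V;
  lieDl : forall x y z, lie (x + y) z = lie x z + lie y z;
  lieDr : forall x y z, lie x (y + z) = lie x y + lie x z;
  lieZl : forall a x y, lie (a *: x) y = a *: lie x y;
  lieZr : forall a x y, lie x (a *: y) = a *: lie x y;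
  liexx : forall x, lie x x = 0;
  lie_jacobi : forall x y z,
    lie x (lie y z) + lie y (lie z x) + lie z (lie x y) = 0
}.

#[short(type="lieAlgType")]
HB.structure Definition LieAlgebra (K : comNzRingType) :=
  {V of GRing.Lmodule K V & Lmodule_isLieAlgebra K V}.

Notation "[< x , y >]" := (lie x y) : ring_scope.

Section LieTheory.
Variables (K : comNzRingType) (L : lieAlgType K).
Implicit Types (x y z : L) (A B : set L).

Lemma lieC x y : [<x, y>] = - [<y, x>].
Proof.
have := liexx (x + y); rewrite lieDl !lieDr !liexx add0r addr0.
by move/eqP; rewrite addr_eq0 => /eqP.
Qed.

Lemma lie0l x : [<0, x>] = 0.
Proof. by rewrite -(scale0r (0 : L)) lieZl !scale0r. Qed.

Lemma lie0r x : [<x, 0>] = 0.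
Proof. by rewrite lieC lie0l oppr0. Qed.

Lemma lieNl x y : [<- x, y>] = - [<x, y>].
Proof. by rewrite -scaleN1r lieZl scaleN1r. Qed.

Lemma lieNr x y : [<x, - y>] = - [<x, y>].
Proof. by rewrite -scaleN1r lieZr scaleN1r. Qed.

Lemma lieBl x y z : [<x - y, z>] = [<x, z>] - [<y, z>].
Proof. by rewrite lieDl lieNl. Qed.

Lemma lieBr x y z : [<x, y - z>] = [<x, y>] - [<x, z>].
Proof. by rewrite lieDr lieNr. Qed.

Lemma lie_derivation x y z :
  [<[<x, y>], z>] = [<[<x, z>], y>] + [<x, [<y, z>]>].
Proof.
have /eqP := lie_jacobi x y z.
rewrite (lieC z [<x, y>]) subr_eq0 => /eqP <-.
by rewrite addrC; congr (_ + _); rewrite lieC -lieNl -lieC.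
Qed.

Definition lin_subspace A :=
  A 0 /\ forall (a : K) x y, A x -> A y -> A (a *: x + y).

Definition lie_subalgebra A :=
  lin_subspace A /\ forall x y, A x -> A y -> A [<x, y>].

Definition lie_generated A : set L := smallest lie_subalgebra A.

Definition lie_set A B : set L :=
  smallest lin_subspace [set z | exists x y, [/\ A x, B y & z = [<x, y>]]].

Definition derived : set L := lie_set setT setT.

Definition derived2 : set L := lie_set derived derived.

Definition metabelian := forall x y z t : L, [<[<x, y>], [<z, t>]>] = 0.

End LieTheory.

Arguments derived {K} L.
Arguments derived2 {K} L.
Arguments metabelian {K} L.

Record lieIdeal (K : comNzRingType) (L : lieAlgType K) := LieIdeal {
  lieIdeal_set :> L -> Prop;
  lieIdeal_subspace : lin_subspace (lieIdeal_set : set L);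
  lieIdeal_lie : forall x y, lieIdeal_set x -> lieIdeal_set [<x, y>]
}.

Section Quotient.
Variables (K : comNzRingType) (L : lieAlgType K) (I : lieIdeal L).

Definition lieIdeal_pred : {pred L} := [pred x | `[< I x >]].

Lemma lieIdeal_predP x : reflect (I x) (x \in lieIdeal_pred).
Proof. exact: asboolP. Qed.

Fact lieIdeal_zmod_closed : zmod_closed lieIdeal_pred.
Proof.
have [I0 IB] := lieIdeal_subspace I.
split=> [|x y /lieIdeal_predP Ix /lieIdeal_predP Iy]; apply/lieIdeal_predP=> //.
by rewrite addrC -scaleN1r; apply: IB.
Qed.

HB.instance Definition _ :=
  GRing.isZmodClosed.Build L lieIdeal_pred lieIdeal_zmod_closed.

Definition lie_quot : Type := Quotient.quot lieIdeal_pred.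

HB.instance Definition _ := GRing.Zmodule.on lie_quot.
HB.instance Definition _ := EqQuotient.on lie_quot.

Local Notation piQ := (\pi_lie_quot : L -> lie_quot).

Lemma lie_quot_eq x y : (piQ x = piQ y) <-> I (x - y).
Proof.
have E := Quotient.idealrBE lieIdeal_pred x y.
split=> [xy|/lieIdeal_predP]; last by rewrite E => /eqP.
by apply/lieIdeal_predP; rewrite E; apply/eqP.
Qed.

Lemma lie_quotP (u : lie_quot) : exists x, u = piQ x.
Proof. by exists (repr u); rewrite reprK. Qed.

Lemma piQD x y : piQ (x + y) = piQ x + piQ y.
Proof. exact: Quotient.pi_add. Qed.

Lemma lieIdealD x y : I x -> I y -> I (x + y).
Proof.
have [_ IB] := lieIdeal_subspace I.
by move=> Ix Iy; rewrite -(scale1r x); apply: IB.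
Qed.

Lemma lieIdealZ a x : I x -> I (a *: x).
Proof.
have [I0 IB] := lieIdeal_subspace I.
by move=> Ix; rewrite -[_ *: _]addr0; apply: IB.
Qed.

Lemma lieIdeal_lier x y : I y -> I [<x, y>].
Proof.
by move=> Iy; rewrite lieC -scaleN1r; apply/lieIdealZ/lieIdeal_lie.
Qed.

Definition lie_quot_scale (a : K) (u : lie_quot) : lie_quot :=
  piQ (a *: repr u).

Definition lie_quot_lie (u v : lie_quot) : lie_quot :=
  piQ [<repr u, repr v>].

Lemma piQZ a x : lie_quot_scale a (piQ x) = piQ (a *: x).
Proof.
apply/lie_quot_eq; rewrite -scalerBr; apply: lieIdealZ.
by apply/lie_quot_eq; rewrite reprK.
Qed.

Lemma piQL x y : lie_quot_lie (piQ x) (piQ y) = piQ [<x, y>].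
Proof.
apply/lie_quot_eq; set x' := repr _; set y' := repr _.
have xI : I (x' - x) by apply/lie_quot_eq; rewrite reprK.
have yI : I (y' - y) by apply/lie_quot_eq; rewrite reprK.
have -> : [<x', y'>] - [<x, y>] = [<x' - x, y'>] + [<x, y' - y>].
  by rewrite lieBl lieBr addrA subrK.
by apply: lieIdealD; [apply: lieIdeal_lie | apply: lieIdeal_lier].
Qed.

Fact lie_quot_scaleA a b u :
  lie_quot_scale a (lie_quot_scale b u) = lie_quot_scale (a * b) u.
Proof. by have [x ->] := lie_quotP u; rewrite !piQZ scalerA. Qed.

Fact lie_quot_scale1 : left_id 1 lie_quot_scale.
Proof. by move=> u; have [x ->] := lie_quotP u; rewrite !piQZ scale1r. Qed.

Fact lie_quot_scaleDr : right_distributive lie_quot_scale +%R.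
Proof.
move=> a u v; have [x ->] := lie_quotP u; have [y ->] := lie_quotP v.
by rewrite -piQD !piQZ -piQD scalerDr.
Qed.

Fact lie_quot_scaleDl u :
  {morph lie_quot_scale^~ u : a b / a + b}.
Proof.
by move=> a b; have [x ->] := lie_quotP u; rewrite !piQZ -piQD scalerDl.
Qed.

HB.instance Definition _ := GRing.Zmodule_isLmodule.Build K lie_quot
  lie_quot_scaleA lie_quot_scale1 lie_quot_scaleDr lie_quot_scaleDl.

Lemma lie_quot_scaleE a x : a *: piQ x = piQ (a *: x).
Proof. exact: piQZ. Qed.

Fact lie_quot_lieDl u v w :
  lie_quot_lie (u + v) w = lie_quot_lie u w + lie_quot_lie v w.
Proof.
have [x ->] := lie_quotP u; have [y ->] := lie_quotP v.
by have [z ->] := lie_quotP w; rewrite -piQD !piQL -piQD lieDl.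
Qed.

Fact lie_quot_lieDr u v w :
  lie_quot_lie u (v + w) = lie_quot_lie u v + lie_quot_lie u w.
Proof.
have [x ->] := lie_quotP u; have [y ->] := lie_quotP v.
by have [z ->] := lie_quotP w; rewrite -piQD !piQL -piQD lieDr.
Qed.

Fact lie_quot_lieZl a u v :
  lie_quot_lie (a *: u) v = a *: lie_quot_lie u v.
Proof.
have [x ->] := lie_quotP u; have [y ->] := lie_quotP v.
by rewrite lie_quot_scaleE !piQL lie_quot_scaleE lieZl.
Qed.

Fact lie_quot_lieZr a u v :
  lie_quot_lie u (a *: v) = a *: lie_quot_lie u v.
Proof.
have [x ->] := lie_quotP u; have [y ->] := lie_quotP v.
by rewrite lie_quot_scaleE !piQL lie_quot_scaleE lieZr.
Qed.

Lemma piQ0 : piQ 0 = 0.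
Proof. by apply: (addrI (piQ 0)); rewrite -piQD !addr0. Qed.

Fact lie_quot_liexx u : lie_quot_lie u u = 0.
Proof. by have [x ->] := lie_quotP u; rewrite piQL liexx piQ0. Qed.

Fact lie_quot_jacobi u v w :
  lie_quot_lie u (lie_quot_lie v w) + lie_quot_lie v (lie_quot_lie w u)
    + lie_quot_lie w (lie_quot_lie u v) = 0.
Proof.
have [x ->] := lie_quotP u; have [y ->] := lie_quotP v.
by have [z ->] := lie_quotP w; rewrite !piQL -!piQD lie_jacobi piQ0.
Qed.

HB.instance Definition _ := Lmodule_isLieAlgebra.Build K lie_quot
  lie_quot_lieDl lie_quot_lieDr lie_quot_lieZl lie_quot_lieZr
  lie_quot_liexx lie_quot_jacobi.

Definition lie_quot_pi (x : L) : lie_quot := piQ x.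

Fact lie_quot_pi_linear : linear lie_quot_pi.
Proof. by move=> a x y; rewrite /lie_quot_pi piQD lie_quot_scaleE. Qed.

HB.instance Definition _ := GRing.isLinear.Build K L lie_quot *:%R
  lie_quot_pi lie_quot_pi_linear.

Lemma lie_quot_pi_lie x y :
  lie_quot_pi [<x, y>] = [<lie_quot_pi x, lie_quot_pi y>].
Proof. by rewrite -[RHS]/(lie_quot_lie _ _) piQL. Qed.

Lemma lie_quot_pi_eq0 x : (lie_quot_pi x = 0) <-> I x.
Proof. by rewrite -piQ0 lie_quot_eq subr0. Qed.

End Quotient.

Section DerivedIdeal.
Variables (K : comNzRingType) (L : lieAlgType K).
Implicit Types (A B : set L).

Lemma lie_set_subspace A B : lin_subspace (lie_set A B).
Proof.
split=> [C [[C0 _] _] //|a x y Sx Sy C CG].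
by have [[_ CD] _] := CG; apply: CD; [apply: Sx | apply: Sy].
Qed.

Lemma lie_set_lie A B x y : A x -> B y -> lie_set A B [<x, y>].
Proof. by move=> Ax By C [_]; apply; exists x, y. Qed.

Lemma derived_lie (x y : L) : derived L [<x, y>].
Proof. exact: lie_set_lie. Qed.

Fact derived2_lie (x y : L) : derived2 L x -> derived2 L [<x, y>].
Proof.
have [D0 DD] := lie_set_subspace (derived L) (derived L).
apply: (smallest_sub (X := [set z | derived2 L [<z, y>]])).
  split=> [|a z t /= Dz Dt]; first by rewrite /= lie0l.
  by rewrite lieDl lieZl; apply: DD.
move=> _ /= [z [t [Dz Dt ->]]]; rewrite lie_derivation -[X in X + _]scale1r.
by apply: DD; apply: lie_set_lie => //; apply: derived_lie.
Qed.

Definition derived2_ideal : lieIdeal L :=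
  LieIdeal (lie_set_subspace (derived L) (derived L)) derived2_lie.

End DerivedIdeal.

Section FreeLie.
Variables (K : comNzRingType) (X : Type).

Inductive lie_term : Type :=
| LVar of X
| LZero
| LAdd of lie_term & lie_term
| LOpp of lie_term
| LScale of K & lie_term
| LLie of lie_term & lie_term.

(* The least congruence that makes the quotient a Lie algebra over K. *)
Inductive lie_cong : lie_term -> lie_term -> Prop :=
| lcong_refl s : lie_cong s s
| lcong_sym s t : lie_cong s t -> lie_cong t s
| lcong_trans s t u : lie_cong s t -> lie_cong t u -> lie_cong s u
| lcong_add s s' t t' :
    lie_cong s s' -> lie_cong t t' -> lie_cong (LAdd s t) (LAdd s' t')
| lcong_opp s s' : lie_cong s s' -> lie_cong (LOpp s) (LOpp s')
| lcong_scale a s s' : lie_cong s s' -> lie_cong (LScale a s) (LScale a s')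
| lcong_lie s s' t t' :
    lie_cong s s' -> lie_cong t t' -> lie_cong (LLie s t) (LLie s' t')
| lcong_addA s t u : lie_cong (LAdd s (LAdd t u)) (LAdd (LAdd s t) u)
| lcong_addC s t : lie_cong (LAdd s t) (LAdd t s)
| lcong_add0 s : lie_cong (LAdd LZero s) s
| lcong_addN s : lie_cong (LAdd (LOpp s) s) LZero
| lcong_scaleA a b s : lie_cong (LScale a (LScale b s)) (LScale (a * b) s)
| lcong_scale1 s : lie_cong (LScale 1 s) s
| lcong_scaleDr a s t :
    lie_cong (LScale a (LAdd s t)) (LAdd (LScale a s) (LScale a t))
| lcong_scaleDl a b s :
    lie_cong (LScale (a + b) s) (LAdd (LScale a s) (LScale b s))
| lcong_lieDl s t u :
    lie_cong (LLie (LAdd s t) u) (LAdd (LLie s u) (LLie t u))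
| lcong_lieDr s t u :
    lie_cong (LLie s (LAdd t u)) (LAdd (LLie s t) (LLie s u))
| lcong_lieZl a s t : lie_cong (LLie (LScale a s) t) (LScale a (LLie s t))
| lcong_lieZr a s t : lie_cong (LLie s (LScale a t)) (LScale a (LLie s t))
| lcong_liess s : lie_cong (LLie s s) LZero
| lcong_jacobi s t u :
    lie_cong (LAdd (LAdd (LLie s (LLie t u)) (LLie t (LLie u s)))
                   (LLie u (LLie s t))) LZero.

HB.instance Definition _ := gen_eqMixin lie_term.
HB.instance Definition _ := gen_choiceMixin lie_term.

Definition lie_congb (s t : lie_term) : bool := `[< lie_cong s t >].

Fact lie_congb_equiv : equiv_class_of lie_congb.
Proof.
split=> [s|s t|t s u].
- exact/asboolP/lcong_refl.
- by apply/asboolP/asboolP=> ?; apply: lcong_sym.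
- move=> /asboolP st /asboolP tu; apply/asboolP; exact: lcong_trans st tu.
Qed.

Canonical lie_congb_equivRel := EquivRelPack lie_congb_equiv.

Definition freeLie : Type := {eq_quot lie_congb}.

HB.instance Definition _ := Choice.on freeLie.
HB.instance Definition _ := EqQuotient.on freeLie.

Local Notation cl := (\pi_freeLie : lie_term -> freeLie).

Lemma freeLie_eq s t : cl s = cl t <-> lie_cong s t.
Proof. by split=> [/eqmodP/asboolP|st]; last exact/eqmodP/asboolP. Qed.

Lemma freeLieP (u : freeLie) : exists s, u = cl s.
Proof. by exists (repr u); rewrite reprK. Qed.

Lemma repr_cl s : lie_cong (repr (cl s)) s.
Proof. by apply/freeLie_eq; rewrite reprK. Qed.

Definition fl_add (u v : freeLie) : freeLie := cl (LAdd (repr u) (repr v)).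
Definition fl_opp (u : freeLie) : freeLie := cl (LOpp (repr u)).
Definition fl_scale (a : K) (u : freeLie) : freeLie := cl (LScale a (repr u)).
Definition fl_lie (u v : freeLie) : freeLie := cl (LLie (repr u) (repr v)).

Lemma fl_addE s t : fl_add (cl s) (cl t) = cl (LAdd s t).
Proof. by apply/freeLie_eq/lcong_add; apply: repr_cl. Qed.
Lemma fl_oppE s : fl_opp (cl s) = cl (LOpp s).
Proof. by apply/freeLie_eq/lcong_opp; apply: repr_cl. Qed.
Lemma fl_scaleE a s : fl_scale a (cl s) = cl (LScale a s).
Proof. by apply/freeLie_eq/lcong_scale; apply: repr_cl. Qed.
Lemma fl_lieE s t : fl_lie (cl s) (cl t) = cl (LLie s t).
Proof. by apply/freeLie_eq/lcong_lie; apply: repr_cl. Qed.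

Let clE := (fl_addE, fl_oppE, fl_scaleE, fl_lieE).

Fact fl_addA : associative fl_add.
Proof.
move=> u v w; case: (freeLieP u) (freeLieP v) (freeLieP w) => s -> [t ->] [r ->].
by rewrite !clE; apply/freeLie_eq/lcong_addA.
Qed.

Fact fl_addC : commutative fl_add.
Proof.
move=> u v; case: (freeLieP u) (freeLieP v) => s -> [t ->].
by rewrite !clE; apply/freeLie_eq/lcong_addC.
Qed.

Fact fl_add0 : left_id (cl LZero) fl_add.
Proof.
by move=> u; case: (freeLieP u) => s ->; rewrite clE; apply/freeLie_eq/lcong_add0.
Qed.

Fact fl_addN : left_inverse (cl LZero) fl_opp fl_add.
Proof.
move=> u; case: (freeLieP u) => s ->.
by rewrite !clE; apply/freeLie_eq/lcong_addN.
Qed.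

HB.instance Definition _ :=
  GRing.isZmodule.Build freeLie fl_addA fl_addC fl_add0 fl_addN.

Lemma freeLie_addE s t : cl s + cl t = cl (LAdd s t).
Proof. exact: fl_addE. Qed.

Lemma freeLie_oppE s : - cl s = cl (LOpp s).
Proof. exact: fl_oppE. Qed.

Fact fl_scaleA a b u : fl_scale a (fl_scale b u) = fl_scale (a * b) u.
Proof.
case: (freeLieP u) => s ->.
by rewrite !clE; apply/freeLie_eq/lcong_scaleA.
Qed.

Fact fl_scale1 : left_id 1 fl_scale.
Proof.
move=> u; case: (freeLieP u) => s ->.
by rewrite !clE; apply/freeLie_eq/lcong_scale1.
Qed.

Fact fl_scaleDr : right_distributive fl_scale +%R.
Proof.
move=> a u v; case: (freeLieP u) (freeLieP v) => s -> [t ->].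
by rewrite freeLie_addE !clE freeLie_addE; apply/freeLie_eq/lcong_scaleDr.
Qed.

Fact fl_scaleDl u : {morph fl_scale^~ u : a b / a + b}.
Proof.
move=> a b; case: (freeLieP u) => s ->.
by rewrite !clE freeLie_addE; apply/freeLie_eq/lcong_scaleDl.
Qed.

HB.instance Definition _ := GRing.Zmodule_isLmodule.Build K freeLie
  fl_scaleA fl_scale1 fl_scaleDr fl_scaleDl.

Lemma freeLie_scaleE a s : a *: cl s = cl (LScale a s).
Proof. exact: fl_scaleE. Qed.

Let clE' := (freeLie_addE, freeLie_scaleE, fl_lieE).

Fact fl_lieDl u v w : fl_lie (u + v) w = fl_lie u w + fl_lie v w.
Proof.
case: (freeLieP u) (freeLieP v) (freeLieP w) => s -> [t ->] [r ->].
by rewrite !clE'; apply/freeLie_eq/lcong_lieDl.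
Qed.

Fact fl_lieDr u v w : fl_lie u (v + w) = fl_lie u v + fl_lie u w.
Proof.
case: (freeLieP u) (freeLieP v) (freeLieP w) => s -> [t ->] [r ->].
by rewrite !clE'; apply/freeLie_eq/lcong_lieDr.
Qed.

Fact fl_lieZl a u v : fl_lie (a *: u) v = a *: fl_lie u v.
Proof.
case: (freeLieP u) (freeLieP v) => s -> [t ->].
by rewrite !clE'; apply/freeLie_eq/lcong_lieZl.
Qed.

Fact fl_lieZr a u v : fl_lie u (a *: v) = a *: fl_lie u v.
Proof.
case: (freeLieP u) (freeLieP v) => s -> [t ->].
by rewrite !clE'; apply/freeLie_eq/lcong_lieZr.
Qed.

Fact fl_liexx u : fl_lie u u = 0.
Proof.
case: (freeLieP u) => s ->.
by rewrite !clE'; apply/freeLie_eq/lcong_liess.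
Qed.

Fact fl_jacobi u v w :
  fl_lie u (fl_lie v w) + fl_lie v (fl_lie w u) + fl_lie w (fl_lie u v) = 0.
Proof.
case: (freeLieP u) (freeLieP v) (freeLieP w) => s -> [t ->] [r ->].
by rewrite !clE'; apply/freeLie_eq/lcong_jacobi.
Qed.

HB.instance Definition _ := Lmodule_isLieAlgebra.Build K freeLie
  fl_lieDl fl_lieDr fl_lieZl fl_lieZr fl_liexx fl_jacobi.

Lemma freeLie_lieE s t : [<cl s, cl t>] = cl (LLie s t).
Proof. exact: fl_lieE. Qed.

Definition freeLie_gen (x : X) : freeLie := cl (LVar x).

Section Lift.
Variables (A : lieAlgType K) (f : X -> A).

Fixpoint lie_eval (s : lie_term) : A :=
  match s with
  | LVar x => f x
  | LZero => 0
  | LAdd s t => lie_eval s + lie_eval t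
  | LOpp s => - lie_eval s
  | LScale a s => a *: lie_eval s
  | LLie s t => [<lie_eval s, lie_eval t>]
  end.

Lemma lie_eval_cong s t : lie_cong s t -> lie_eval s = lie_eval t.
Proof.
elim=> //= *; first [ by congruence | exact: addrA | exact: addrC
  | exact: add0r | exact: addNr | exact: scalerA | exact: scale1r
  | exact: scalerDr | exact: scalerDl | exact: lieDl | exact: lieDr
  | exact: lieZl | exact: lieZr | exact: liexx | exact: lie_jacobi ].
Qed.

Definition freeLie_lift (u : freeLie) : A := lie_eval (repr u).

Lemma freeLie_liftE s : freeLie_lift (cl s) = lie_eval s.
Proof. exact/lie_eval_cong/repr_cl. Qed.

Lemma freeLie_lift_gen x : freeLie_lift (freeLie_gen x) = f x.
Proof. exact: freeLie_liftE. Qed.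

Fact freeLie_lift_linear : linear freeLie_lift.
Proof.
move=> a u v; case: (freeLieP u) (freeLieP v) => s -> [t ->].
by rewrite freeLie_scaleE freeLie_addE !freeLie_liftE.
Qed.

HB.instance Definition _ := GRing.isLinear.Build K freeLie A *:%R
  freeLie_lift freeLie_lift_linear.

Lemma freeLie_lift_lie u v :
  freeLie_lift [<u, v>] = [<freeLie_lift u, freeLie_lift v>].
Proof.
case: (freeLieP u) (freeLieP v) => s -> [t ->].
by rewrite freeLie_lieE !freeLie_liftE.
Qed.

Lemma freeLie_lift_unique (g : {linear freeLie -> A}) :
  (forall u v, g [<u, v>] = [<g u, g v>]) ->
  (forall x, g (freeLie_gen x) = f x) -> g =1 freeLie_lift.
Proof.
move=> gL gX u; case: (freeLieP u) => s ->; rewrite freeLie_liftE.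
elim: s => [x||s IHs t IHt|s IHs|a s IHs|s IHs t IHt] /=.
- exact: gX.
- by rewrite -[cl LZero]/(0 : freeLie) raddf0.
- by rewrite -freeLie_addE raddfD /= IHs IHt.
- by rewrite -freeLie_oppE raddfN /= IHs.
- by rewrite -freeLie_scaleE linearZ /= IHs.
- by rewrite -freeLie_lieE gL IHs IHt.
Qed.

End Lift.
End FreeLie.

Section FreeMetabelian.
Variables (K : comNzRingType) (n : nat).

Definition freeMet : Type := lie_quot (derived2_ideal (freeLie K 'I_n)).

HB.instance Definition _ := LieAlgebra.on freeMet.

Definition freeMet_pi : freeLie K 'I_n -> freeMet :=
  @lie_quot_pi K _ (derived2_ideal (freeLie K 'I_n)).

Definition freeMet_gen (i : 'I_n) : freeMet := freeMet_pi (freeLie_gen K i).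

Lemma freeMet_metabelian : metabelian freeMet.
Proof.
move=> u v w z.
have [[a ->] [b ->]] := (lie_quotP u, lie_quotP v).
have [[c ->] [d ->]] := (lie_quotP w, lie_quotP z).
rewrite -![\pi _]/(lie_quot_pi _ _) -!lie_quot_pi_lie.
apply/(lie_quot_pi_eq0 (derived2_ideal _)).
by apply: (@lie_set_lie _ _ (derived _) (derived _)); apply: derived_lie.
Qed.

Section Lift.
Variables (A : lieAlgType K) (f : 'I_n -> A).

(* Independent of the chosen representative when A is metabelian, see
   freeMet_lift_pi. *)
Definition freeMet_lift (u : freeMet) : A :=
  freeLie_lift f (repr (u : lie_quot _)).

Hypothesis metA : metabelian A.

Lemma freeLie_lift_derived2 x :
  derived2 (freeLie K 'I_n) x -> freeLie_lift f x = 0.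
Proof.
have ker_sub y : derived (freeLie K 'I_n) y -> derived A (freeLie_lift f y).
  have [D0 DD] := lie_set_subspace (@setT A) setT.
  apply: (smallest_sub (X := [set z | derived A (freeLie_lift f z)])).
    split=> [|a z t /= Dz Dt]; first by rewrite /= raddf0.
    by rewrite linearP; apply: DD.
  by move=> _ [z [t [_ _ ->]]] /=; rewrite freeLie_lift_lie; apply: derived_lie.
have com (y z : A) : derived A y -> derived A z -> [<y, z>] = 0.
  move=> Dy Dz; move: y Dy.
  apply: (smallest_sub (X := [set y | [<y, z>] = 0])).
    split=> [|a y t /= y0 t0]; first exact: lie0l.
    by rewrite lieDl lieZl y0 t0 scaler0 addr0.
  move=> _ [y [t [_ _ ->]]] /=; move: z Dz.
  apply: (smallest_sub (X := [set z | [<[<y, t>], z>] = 0])).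
    split=> [|a z s /= z0 s0]; first exact: lie0r.
    by rewrite lieDr lieZr z0 s0 scaler0 addr0.
  by move=> _ [z [s [_ _ ->]]] /=.
apply: (smallest_sub (X := [set z | freeLie_lift f z = 0])).
  split=> [|a z t /= z0 t0]; first exact: raddf0.
  by rewrite /= linearP /= z0 t0 scaler0 addr0.
move=> _ [y [z [Dy Dz ->]]] /=; rewrite freeLie_lift_lie.
by apply: com; apply: ker_sub.
Qed.

Lemma freeMet_lift_pi x : freeMet_lift (freeMet_pi x) = freeLie_lift f x.
Proof.
apply/eqP; rewrite -subr_eq0 -raddfB; apply/eqP/freeLie_lift_derived2.
by apply/(lie_quot_eq (derived2_ideal _)); rewrite reprK.
Qed.

Lemma freeMetP (u : freeMet) : exists x, u = freeMet_pi x.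
Proof. exact: lie_quotP. Qed.

Lemma freeMet_lift_gen i : freeMet_lift (freeMet_gen i) = f i.
Proof. by rewrite freeMet_lift_pi freeLie_lift_gen. Qed.

Lemma freeMet_lift_linear : linear freeMet_lift.
Proof.
move=> a u v; case: (freeMetP u) (freeMetP v) => x -> [y ->].
by rewrite -[_ *: _ + _]linearP !freeMet_lift_pi linearP.
Qed.

Lemma freeMet_lift_lie u v :
  freeMet_lift [<u, v>] = [<freeMet_lift u, freeMet_lift v>].
Proof.
case: (freeMetP u) (freeMetP v) => x -> [y ->].
rewrite -[[<_, _>]]lie_quot_pi_lie -[lie_quot_pi _ _]/(freeMet_pi _).
by rewrite !freeMet_lift_pi freeLie_lift_lie.
Qed.

End Lift.

Definition sym_act (s : 'S_n) : freeMet -> freeMet :=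
  freeMet_lift (fun i => freeMet_gen (s i)).

Definition sym_invariants : set freeMet :=
  [set f | forall s : 'S_n, sym_act s f = f].

End FreeMetabelian.

Section Wreath.
Variables (K : comNzRingType) (n : nat).

(* The coordinates of an element of the free right module with respect to the
   generators u_1, ..., u_n. *)
Definition wmod : Type := {ffun 'I_n -> {mpoly K[n]}}.

HB.instance Definition _ := GRing.Lmodule.on wmod.

Definition wmulr (w : wmod) (p : {mpoly K[n]}) : wmod := [ffun i => w i * p].

Definition wgen (i : 'I_n) : wmod := [ffun k => (k == i)%:R].

Local Notation "w *r p" := (wmulr w p).

Definition wreath : Type := (wmod * 'rV[K]_n)%type.

HB.instance Definition _ := GRing.Lmodule.on wreath.

(* The linear polynomial through which an element of K V_n acts on W_n: v_j acts
   as multiplication by x_j. *)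
Definition vlin (b : 'rV[K]_n) : {mpoly K[n]} := \sum_j b 0 j *: 'X_j.

Definition wreath_lie (x y : wreath) : wreath :=
  (x.1 *r vlin y.2 - y.1 *r vlin x.2, 0).

Definition inW (w : wmod) : wreath := (w, 0).
Definition inV (b : 'rV[K]_n) : wreath := (0, b).
Definition vgen (j : 'I_n) : 'rV[K]_n := delta_mx 0 j.

Lemma wmulrDl w w' p : (w + w') *r p = w *r p + w' *r p.
Proof. by apply/ffunP=> i; rewrite !ffunE mulrDl. Qed.

Lemma wmulrDr w p q : w *r (p + q) = w *r p + w *r q.
Proof. by apply/ffunP=> i; rewrite !ffunE mulrDr. Qed.

Lemma wmulrZl a w p : (a *: w) *r p = a *: (w *r p).
Proof. by apply/ffunP=> i; rewrite !ffunE scalerAl. Qed.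

Lemma wmulrZr a w p : w *r (a *: p) = a *: (w *r p).
Proof. by apply/ffunP=> i; rewrite !ffunE scalerAr. Qed.

Lemma wmulrA w p q : (w *r p) *r q = w *r (p * q).
Proof. by apply/ffunP=> i; rewrite !ffunE mulrA. Qed.

Lemma wmulr0 w : w *r 0 = 0.
Proof. by apply/ffunP=> i; rewrite !ffunE mulr0. Qed.

Lemma wmul0r p : 0 *r p = 0.
Proof. by apply/ffunP=> i; rewrite !ffunE mul0r. Qed.

Lemma wmulrBl w w' p : (w - w') *r p = w *r p - w' *r p.
Proof. by apply/ffunP=> i; rewrite !ffunE mulrBl. Qed.

Fact vlin_linear : linear vlin.
Proof.
move=> a b c; rewrite /vlin scaler_sumr -big_split /=.
by apply: eq_bigr => j _; rewrite !mxE scalerDl scalerA.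
Qed.

HB.instance Definition _ :=
  GRing.isLinear.Build K 'rV[K]_n {mpoly K[n]} *:%R vlin vlin_linear.

Fact wreath_lieDl x y z :
  wreath_lie (x + y) z = wreath_lie x z + wreath_lie y z.
Proof.
rewrite /wreath_lie /= -[RHS]/(_ + _, _ + _) addr0; congr (_, _).
by rewrite raddfD /= wmulrDl wmulrDr opprD addrACA.
Qed.

Fact wreath_lieC x y : wreath_lie x y = - wreath_lie y x.
Proof.
by rewrite /wreath_lie -[RHS]/(- _, - _) oppr0 opprB.
Qed.

Fact wreath_lieDr x y z :
  wreath_lie x (y + z) = wreath_lie x y + wreath_lie x z.
Proof. by rewrite wreath_lieC wreath_lieDl opprD -!wreath_lieC. Qed.

Fact wreath_lieZl a x y : wreath_lie (a *: x) y = a *: wreath_lie x y.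
Proof.
rewrite /wreath_lie /= -[RHS]/(_ *: _, _ *: _) scaler0; congr (_, _).
by rewrite linearZ /= wmulrZl wmulrZr scalerBr.
Qed.

Fact wreath_lieZr a x y : wreath_lie x (a *: y) = a *: wreath_lie x y.
Proof. by rewrite wreath_lieC wreath_lieZl -scalerN -wreath_lieC. Qed.

Fact wreath_liexx x : wreath_lie x x = 0.
Proof. by rewrite /wreath_lie subrr. Qed.

Fact wreath_jacobi x y z :
  wreath_lie x (wreath_lie y z) + wreath_lie y (wreath_lie z x)
    + wreath_lie z (wreath_lie x y) = 0.
Proof.
case: x y z => [x a] [y b] [z c]; rewrite /wreath_lie /= raddf0 !wmulr0 !sub0r.
rewrite -[LHS]/(_ + _ + _, _ + _ + _) !addr0; congr (_, _).
apply/ffunP=> i; rewrite !ffunE.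
set A := vlin a; set B := vlin b; set C := vlin c.
rewrite !mulrBl -!mulrA (mulrC C A) (mulrC C B) (mulrC B A) !opprB.
by rewrite [X in X + _]addrC [X in X + _]addrA subrK addrA subrK subrr.
Qed.

HB.instance Definition _ := Lmodule_isLieAlgebra.Build K wreath
  wreath_lieDl wreath_lieDr wreath_lieZl wreath_lieZr
  wreath_liexx wreath_jacobi.

Lemma lie_inW (w w' : wmod) : [<inW w, inW w'>] = 0.
Proof. by rewrite -[LHS]/(_ - _, 0) /= raddf0 !wmulr0 subrr. Qed.

Lemma lie_inV b c : [<inV b, inV c>] = 0.
Proof. by rewrite -[LHS]/(_ - _, 0) /= !wmul0r subrr. Qed.

Lemma lie_wgen_vgen i j p :
  [<inW (wgen i *r p), inV (vgen j)>] = inW (wgen i *r (p * 'X_j)).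
Proof.
rewrite -[LHS]/(_ - _, 0) /= raddf0 wmulr0 subr0 wmulrA.
congr (_ *r (_ * _), _); rewrite /vlin (bigD1 j) //= mxE !eqxx scale1r.
by rewrite big1 ?addr0 // => k /negPf kj; rewrite mxE eqxx kj scale0r.
Qed.

Lemma wreath_metabelian : metabelian wreath.
Proof. by move=> x y z t; apply: lie_inW. Qed.

Definition delta : freeMet K n -> wreath :=
  freeMet_lift (fun i => inW (wgen i) + inV (vgen i)).

(* epsilon_q for q >= 1; the inner sum is over the (q-1)-subsets avoiding i. *)
Definition epsilon (q : nat) : wmod :=
  \sum_(i < n)
    wgen i *r (\sum_(J : {set 'I_n} | (#|J| == q.-1) && (i \notin J))
                 \prod_(j in J) 'X_j).

Definition hpoly (i j : nat) : wmod :=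
  (epsilon i *r mesym n K j) *+ j - (epsilon j *r mesym n K i) *+ i.

Definition hgen (i j : nat) (a : nat -> nat) : wmod :=
  hpoly i j *r \prod_(2 <= k < n.+1) mesym n K k ^+ a k.

End Wreath.

Arguments freeMet_gen K {n} i.
Arguments sym_invariants K n : clear implicits.
Arguments delta {K n} u.
Arguments inW {K n} w.
Arguments epsilon K n q : clear implicits.
Arguments hpoly K n i j : clear implicits.
Arguments hgen K n i j a : clear implicits.

(* Main.v *)
(* The generators delta(x_i) = u_i + v_i satisfy [delta x_i, delta x_j] =
   u_i x_j - u_j x_i, so delta maps the K[X]-span of the commutators onto the
   Koszul relations; these are all the solutions of sum_i x_i p_i = 0, and a
   linear retraction of delta on commutators shows that delta is injective.

   An invariant of F_n is therefore a multiple of f_1 plus a commutator element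
   whose image w is an S_n-invariant of W_n with sum_i x_i p_i = 0.  By
   averaging over S_n, w = sum_q epsilon_q c_q with c_q symmetric; substituting
   x_i for u_i turns epsilon_q into q e_q, so that sum_q q e_q c_q = 0.  As
   e_1, ..., e_n are algebraically independent and generate the symmetric
   polynomials, the Koszul argument applies once more and produces the h_ij;
   powers of e_1 come from brackets with f_1. *)
From HB Require Import structures.
Require Import Defs.
From mathcomp Require Import all_boot all_order all_algebra perm fingroup.
From mathcomp Require Import boolp classical_sets.
From mathcomp Require Import ssrcomplements mpoly.

Set Implicit Arguments.
Unset Strict Implicit.
Unset Printing Implicit Defensive.

Import GRing.Theory.

Local Open Scope ring_scope.
Local Open Scope classical_set_scope.

Local Notation "w *r p" := (wmulr w p).

(** * Linear maps on polynomials prescribed on monomials *)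

Section MonomialExtension.
Variables (K : comNzRingType) (n : nat) (V : lmodType K).
Variable f : 'X_{1..n} -> V.

Definition mon_ext (p : {mpoly K[n]}) : V := \sum_(m <- msupp p) p@_m *: f m.

(** Summing over all monomials below a common bound, instead of over the support, lets several
    polynomials be compared termwise. *)
Lemma mon_extw k p : (msize p <= k)%N ->
  mon_ext p = \sum_(m : 'X_{1..n < k}) p@_m *: f m.
Proof.
move=> lt_pk; pose I : subFinType _ := 'X_{1..n < k}.
rewrite /mon_ext (big_mksub I) //=; first last.
- by move=> m /msize_mdeg_lt /leq_trans; apply.
- exact: msupp_uniq.
rewrite big_rmcond //= => i /memN_msupp_eq0 ->.
by rewrite scale0r.
Qed.

Lemma mon_ext_is_linear : linear mon_ext.
Proof.
move=> a p q.
pose k := maxn (maxn (msize p) (msize q)) (msize (a *: p + q)).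
have [kp kq kr] : [/\ (msize p <= k)%N, (msize q <= k)%N
                    & (msize (a *: p + q) <= k)%N].
  by rewrite /k !leq_max !leqnn !orbT.
rewrite !(@mon_extw k) // scaler_sumr -big_split /=.
by apply: eq_bigr => m _; rewrite mcoeffD mcoeffZ scalerDl scalerA.
Qed.

HB.instance Definition _ :=
  GRing.isLinear.Build K {mpoly K[n]} V *:%R mon_ext mon_ext_is_linear.

Lemma mon_extX m : mon_ext 'X_[m] = f m.
Proof. by rewrite /mon_ext msuppX big_seq1 mcoeffX eqxx scale1r. Qed.

End MonomialExtension.

(** * Subspaces of modules without a bracket, such as W_n *)

Definition subspace (K : comNzRingType) (V : lmodType K) (A : set V) :=
  A 0 /\ forall (a : K) x y, A x -> A y -> A (a *: x + y).

Section Subspace.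
Variables (K : comNzRingType) (V : lmodType K) (A : set V).
Hypothesis subA : subspace A.

Lemma subspace0 : A 0. Proof. by case: subA. Qed.

Lemma subspaceD x y : A x -> A y -> A (x + y).
Proof. by move=> Ax Ay; rewrite -(scale1r x); apply: subA.2. Qed.

Lemma subspaceZ a x : A x -> A (a *: x).
Proof.
by move=> Ax; rewrite -[_ *: _]addr0; apply: subA.2 => //; apply: subspace0.
Qed.

Lemma subspaceN x : A x -> A (- x).
Proof. by rewrite -scaleN1r; apply: subspaceZ. Qed.

Lemma subspaceB x y : A x -> A y -> A (x - y).
Proof. by move=> Ax Ay; apply/subspaceD => //; apply: subspaceN. Qed.

Lemma subspace_sum (I : Type) (r : seq I) (P : pred I) (F : I -> V) :
  (forall i, P i -> A (F i)) -> A (\sum_(i <- r | P i) F i).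
Proof.
by move=> AF; apply: (big_ind A) => //; [apply: subspace0 | apply: subspaceD].
Qed.

End Subspace.

(** * The free module W_n and the Koszul syzygies of the variables *)

Section Wmod.
Variables (K : comNzRingType) (n : nat).
Local Notation W := (wmod K n).
Local Notation X := 'X_{1..n}.
Implicit Types (w : W) (p : {mpoly K[n]}) (m : X) (i j k : 'I_n).

Lemma wmulr1 w : w *r 1 = w.
Proof. by apply/ffunP=> i; rewrite ffunE mulr1. Qed.

Lemma wmulr_suml (I : Type) (r : seq I) (P : pred I) (F : I -> W) p :
  (\sum_(i <- r | P i) F i) *r p = \sum_(i <- r | P i) F i *r p.
Proof.
exact: (big_morph (fun w => w *r p) (fun v w => wmulrDl v w p) (wmul0r p)).
Qed.

Lemma wmulr_sumr (I : Type) (r : seq I) (P : pred I) (F : I -> {mpoly K[n]}) w :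
  w *r (\sum_(i <- r | P i) F i) = \sum_(i <- r | P i) w *r F i.
Proof. exact: (big_morph (wmulr w) (wmulrDr w) (wmulr0 w)). Qed.

Lemma wgenE i p k : (wgen K i *r p) k = if k == i then p else 0.
Proof. by rewrite !ffunE; case: eqP => _; rewrite ?mul1r ?mul0r. Qed.

Lemma wmod_sum_gen w : w = \sum_i wgen K i *r w i.
Proof.
apply/ffunP=> k; rewrite sum_ffunE (bigD1 k) //= wgenE eqxx big1 ?addr0 // => i.
by rewrite wgenE eq_sym => /negPf ->.
Qed.

Lemma wmod_ind (A : set W) : subspace A ->
  (forall i m, A (wgen K i *r 'X_[m])) -> forall w, A w.
Proof.
move=> subA AX w; rewrite (wmod_sum_gen w); apply: subspace_sum => // i _.
rewrite (mpolyE (w i)) wmulr_sumr; apply: subspace_sum => // m _.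
by rewrite wmulrZr; apply: subspaceZ.
Qed.

Section Extension.
Variables (V : lmodType K) (f : 'I_n -> X -> V).

Definition wmod_ext w : V := \sum_i mon_ext (f i) (w i).

Lemma wmod_ext_is_linear : linear wmod_ext.
Proof.
move=> a v w; rewrite scaler_sumr -big_split /=.
by apply: eq_bigr => i _; rewrite !ffunE linearP.
Qed.

HB.instance Definition _ :=
  GRing.isLinear.Build K W V *:%R wmod_ext wmod_ext_is_linear.

Lemma wmod_extX i m : wmod_ext (wgen K i *r 'X_[m]) = f i m.
Proof.
rewrite /wmod_ext (bigD1 i) //= wgenE eqxx mon_extX big1 ?addr0 // => k ki.
by rewrite wgenE (negPf ki) raddf0.
Qed.

End Extension.

(** The substitution of x_i for u_i, whose kernel is the image of F_n' under [delta]. *)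
Definition wsubst w : {mpoly K[n]} := \sum_i w i * 'X_i.

Lemma wsubst_is_linear : linear wsubst.
Proof.
move=> a v w; rewrite scaler_sumr -big_split /=; apply: eq_bigr => i _.
by rewrite !ffunE mulrDl scalerAl.
Qed.

HB.instance Definition _ :=
  GRing.isLinear.Build K W {mpoly K[n]} *:%R wsubst wsubst_is_linear.

Lemma wsubstM w p : wsubst (w *r p) = wsubst w * p.
Proof.
by rewrite mulr_suml; apply: eq_bigr => i _; rewrite ffunE mulrAC.
Qed.

Lemma wsubst_gen i p : wsubst (wgen K i *r p) = 'X_i * p.
Proof.
rewrite /wsubst (bigD1 i) //= wgenE eqxx mulrC big1 ?addr0 // => k ki.
by rewrite wgenE (negPf ki) mul0r.
Qed.

(** The image under [delta] of the commutator [x_i, x_j] acted on by x^m; see [delta_koszul]. *)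
Definition koszul i j m : W :=
  (wgen K i *r 'X_j - wgen K j *r 'X_i) *r 'X_[m].

Lemma koszulE i j m :
  koszul i j m = wgen K i *r 'X_[U_(j) + m] - wgen K j *r 'X_[U_(i) + m].
Proof. by rewrite /koszul wmulrBl !wmulrA !mpolyXD. Qed.

Definition first_var m : option 'I_n := [pick i | m i != 0%N].

Lemma first_varU i m : exists k,
  first_var (U_(i) + m) = Some k /\ (k != i -> m k != 0%N).
Proof.
rewrite /first_var; case: pickP => [k mk|/(_ i)]; last first.
  by rewrite mnmDE mnm1E eqxx.
exists k; split=> // ki; move: mk; rewrite mnmDE mnm1E [i == k]eq_sym.
by rewrite (negPf ki).
Qed.

(** A right inverse of [wsubst] on nonconstant monomials; the default 0 is met only at the monomial
    1. *)
Definition koszul_section m : W :=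
  if first_var m is Some k then wgen K k *r 'X_[m - U_(k)] else 0.

(* Replacing each u_i x^m by u_k x^(m + e_i - e_k), with k a variable chosen in
   the monomial x_i x^m, alters w by Koszul elements and leaves a linear
   function of [wsubst w]. *)
Lemma koszul_exact (A : set W) :
  subspace A -> (forall i j m, A (koszul i j m)) ->
  forall w, wsubst w = 0 -> A w.
Proof.
move=> subA AK w w0.
pose rem w : W := w - mon_ext koszul_section (wsubst w).
suff: A (rem w) by rewrite /rem w0 linear0 subr0.
apply: (wmod_ind (A := [set w | A (rem w)])) => {w w0}; rewrite {}/rem.
  split=> [|a v w /= Av Aw].
    by rewrite /= !linear0 addr0; apply: subspace0.
  by rewrite !linearP /= addrACA -scalerDr; apply: subA.2.
move=> i m /=; rewrite wsubst_gen -mpolyXD mon_extX /koszul_section.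
have [k [-> mk]] := first_varU i m.
have [->|/mk {}mk] := eqVneq k i.
  by rewrite addmC addmK subrr; apply: subspace0.
have <- : koszul i k (m - U_(k)) =
          wgen K i *r 'X_[m] - wgen K k *r 'X_[U_(i) + m - U_(k)].
  by rewrite koszulE -addmBA ?lep1mP // [(U_(k) + _)%MM]addmC submK // lep1mP.
exact: AK.
Qed.

End Wmod.

(** * Iterated brackets in a metabelian Lie algebra *)

Section MetabelianLie.
Variables (K : comNzRingType) (L : lieAlgType K).
Implicit Types (x y z : L).

Lemma lie_suml (I : Type) (r : seq I) (P : pred I) (F : I -> L) y :
  [<\sum_(i <- r | P i) F i, y>] = \sum_(i <- r | P i) [<F i, y>].
Proof. exact: (big_morph (lie^~ y) (fun a b => lieDl a b y) (lie0l y)). Qed.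

Lemma lie_sumr (I : Type) (r : seq I) (P : pred I) (F : I -> L) y :
  [<y, \sum_(i <- r | P i) F i>] = \sum_(i <- r | P i) [<y, F i>].
Proof. exact: (big_morph (lie y) (lieDr y) (lie0r y)). Qed.

Lemma lie_generated_subalgebra (A : set L) : lie_subalgebra (lie_generated A).
Proof.
split; [split=> [C [[[]]] //|a x y Ax Ay C CA]|move=> x y Ax Ay C CA].
  by have [[[_ CD] _] _] := CA; apply: CD; [apply: Ax | apply: Ay].
by have [[_ CL] _] := CA; apply: CL; [apply: Ax | apply: Ay].
Qed.

Hypothesis metL : metabelian L.

Lemma lie_derived0 x y : derived L x -> derived L y -> [<x, y>] = 0.
Proof.
move=> Dx Dy; move: x Dx.
apply: (smallest_sub (X := [set x | [<x, y>] = 0])).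
  split=> [|a x z /= x0 z0]; first exact: lie0l.
  by rewrite lieDl lieZl x0 z0 scaler0 addr0.
move=> _ [x [t [_ _ ->]]] /=; move: y Dy.
apply: (smallest_sub (X := [set y | [<[<x, t>], y>] = 0])).
  split=> [|a y s /= y0 s0]; first exact: lie0r.
  by rewrite lieDr lieZr y0 s0 scaler0 addr0.
by move=> _ [y [s [_ _ ->]]] /=.
Qed.

(** By the Jacobi identity the two sides differ by [d, [x, y]], a bracket of two derived elements.
    This is what lets commuting variables act on derived elements. *)
Lemma lie_ad_comm d x y :
  derived L d -> [<[<d, x>], y>] = [<[<d, y>], x>].
Proof.
by move=> Dd; rewrite lie_derivation (lie_derived0 Dd (derived_lie x y)) addr0.
Qed.

Variables (n : nat) (x_ : 'I_n -> L).

Definition lie_seq d (s : seq 'I_n) : L := foldl (fun g i => [<g, x_ i>]) d s.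

Definition mnm_seq (m : 'X_{1..n}) : seq 'I_n :=
  flatten [seq nseq (m i) i | i <- enum 'I_n].

Definition lie_mnm d (m : 'X_{1..n}) : L := lie_seq d (mnm_seq m).

Lemma count_mnm_seq m i : count_mem i (mnm_seq m) = m i.
Proof.
rewrite /mnm_seq count_flatten -map_comp sumnE big_map big_enum /=.
rewrite (bigD1 i) //= count_nseq /= eqxx mul1n big1 ?addn0 // => k ki.
by rewrite count_nseq /= (negPf ki).
Qed.

Lemma mnm_seqU i m : perm_eq (mnm_seq (U_(i) + m)) (i :: mnm_seq m).
Proof.
by apply/allP => k _; rewrite /= !count_mnm_seq mnmDE mnm1E eq_sym.
Qed.

Lemma lie_seq_derived d s : derived L d -> derived L (lie_seq d s).
Proof. by elim: s d => //= i s IHs d _; apply: IHs (derived_lie _ _). Qed.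

Lemma lie_seq_perm d s t :
  derived L d -> perm_eq s t -> lie_seq d s = lie_seq d t.
Proof.
(* Commuting adjacent letters brings any letter to the front. *)
have mid i s1 s2 e : derived L e ->
    lie_seq e (s1 ++ i :: s2) = lie_seq e (i :: s1 ++ s2).
  elim: s1 e => //= k s1 IHs e De; rewrite IHs /=; last exact: derived_lie.
  by rewrite lie_ad_comm.
move=> + st; elim: s t st d => [|i s IHs] t st d Dd.
  by rewrite (perm_nilP (_ : perm_eq t [::])) // perm_sym.
have it : i \in t by rewrite -(perm_mem st) mem_head.
case/splitPr: it st => t1 t2.
rewrite perm_sym -cat1s perm_catCA /= perm_cons => st.
by rewrite mid //=; apply: IHs (derived_lie _ _); rewrite perm_sym.
Qed.

Lemma lie_mnmU d i m :
  derived L d -> lie_mnm d (U_(i) + m) = lie_mnm [<d, x_ i>] m.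
Proof. by move=> Dd; rewrite /lie_mnm (lie_seq_perm Dd (mnm_seqU i m)). Qed.

Lemma lie_mnm_lie d i m :
  derived L d -> [<lie_mnm d m, x_ i>] = lie_mnm d (U_(i) + m).
Proof.
move=> Dd; have st : perm_eq (mnm_seq (U_(i) + m)) (rcons (mnm_seq m) i).
  by rewrite perm_sym perm_rcons perm_sym mnm_seqU.
by rewrite /lie_mnm (lie_seq_perm Dd st) /lie_seq foldl_rcons.
Qed.

Lemma lie_mnm0 d : lie_mnm d 0%MM = d.
Proof.
rewrite /lie_mnm; suff -> : mnm_seq 0 = [::] by [].
by rewrite /mnm_seq; elim: (enum _) => //= i s ->; rewrite mnm0E.
Qed.

Lemma lie_mnmD d e m : lie_mnm (d + e) m = lie_mnm d m + lie_mnm e m.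
Proof.
rewrite /lie_mnm; elim: (mnm_seq m) d e => //= i s IHs d e.
by rewrite lieDl IHs.
Qed.

Lemma lie_mnmN d m : lie_mnm (- d) m = - lie_mnm d m.
Proof.
rewrite /lie_mnm; elim: (mnm_seq m) d => //= i s IHs d.
by rewrite lieNl IHs.
Qed.

Lemma lie_mnm00 m : lie_mnm 0 m = 0.
Proof. by rewrite /lie_mnm; elim: (mnm_seq m) => //= i s; rewrite lie0l. Qed.

End MetabelianLie.

(** * Injectivity of [delta] and its image *)

Section FreeMetabelianDelta.
Variables (K : comNzRingType) (n : nat).
Local Notation W := (wmod K n).
Local Notation F := (freeMet K n).
Local Notation x_ := (freeMet_gen K).
Local Notation wr := (wreath K n).
Implicit Types (f g : F) (w : W) (m : 'X_{1..n}) (i j k : 'I_n).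

(** Every element is the class of a Lie term, so structural induction on terms applies. *)
Lemma freeMet_ind (A : set F) :
  lie_subalgebra A -> (forall i, A (x_ i)) -> forall f, A f.
Proof.
move=> [[A0 AD] AL] Ax f; have [u ->] := freeMetP f.
have [s ->] := freeLieP u; rewrite /freeMet_pi.
elim: s => [i||s IHs t IHt|s IHs|a s IHs|s IHs t IHt].
- exact: Ax.
- by rewrite -[X in lie_quot_pi _ X]/(0 : freeLie K 'I_n) raddf0; exact: A0.
- by rewrite -freeLie_addE raddfD -[X in A (X + _)]scale1r; exact: AD.
- by rewrite -freeLie_oppE raddfN -scaleN1r -[X in A X]addr0; exact: AD.
- by rewrite -freeLie_scaleE linearZ -[X in A X]addr0; exact: AD.
- by rewrite -freeLie_lieE lie_quot_pi_lie; exact: AL.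
Qed.

Lemma delta_is_linear : linear (@delta K n).
Proof. exact: freeMet_lift_linear (@wreath_metabelian K n). Qed.

HB.instance Definition _ :=
  GRing.isLinear.Build K F wr *:%R (@delta K n) delta_is_linear.

Lemma delta_lie f g : delta [<f, g>] = [<delta f, delta g>].
Proof. exact: freeMet_lift_lie (@wreath_metabelian K n) f g. Qed.

Lemma delta_gen i : delta (x_ i) = (wgen K i, vgen K i) :> wr.
Proof.
rewrite /delta freeMet_lift_gen; last exact: wreath_metabelian.
by rewrite -[LHS]/(_ + _, _ + _) addr0 add0r.
Qed.

Lemma vlin_gen i : vlin (vgen K i) = 'X_i.
Proof.
rewrite /vlin (bigD1 i) //= mxE !eqxx scale1r big1 ?addr0 // => k ki.
by rewrite mxE (negPf ki) andbF scale0r.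
Qed.

Lemma lie_inW_wreath w (y : wr) : [<inW w, y>] = inW (w *r vlin y.2).
Proof. by rewrite -[LHS]/(_ - _, 0) /= raddf0 wmulr0 subr0. Qed.

Lemma delta_lie_gen i j : delta [<x_ i, x_ j>] = inW (koszul K i j 0).
Proof.
rewrite delta_lie !delta_gen -[LHS]/(_ - _, 0) /= !vlin_gen.
by rewrite /koszul mpolyX0 wmulr1.
Qed.

Lemma delta_lie_mnm f w m :
  delta f = inW w -> delta (lie_mnm x_ f m) = inW (w *r 'X_[m]).
Proof.
move=> fw.
(* Each bracket with x_i multiplies an element of W_n by x_i, since only the component v_i acts on
   it. *)
have seqE s g v : delta g = inW v ->
    delta (lie_seq x_ g s) = inW (v *r 'X_[\sum_(i <- s) U_(i)]).
  elim: s g v => [|i s IHs] g v gv /=; first by rewrite big_nil mpolyX0 wmulr1.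
  rewrite (IHs _ (v *r 'X_i)); first by rewrite wmulrA big_cons mpolyXD.
  by rewrite delta_lie gv delta_gen lie_inW_wreath vlin_gen.
rewrite /lie_mnm (seqE _ _ _ fw); congr (inW (_ *r 'X_[_])).
apply/mnmP=> k; rewrite mnm_sumE -(count_mnm_seq m k) -sum1_count.
by rewrite [RHS]big_mkcond; apply: eq_bigr => i _; rewrite mnm1E /=; case: eqP.
Qed.

Lemma delta_koszul i j m :
  delta (lie_mnm x_ [<x_ i, x_ j>] m) = inW (koszul K i j m).
Proof.
by rewrite (delta_lie_mnm _ (delta_lie_gen i j)) /koszul mpolyX0 wmulr1.
Qed.

(** A working substitute for F_n', on whose spanning elements identities can be checked. *)
Definition comm_span : set F := smallest (@lin_subspace K F)
  [set g | exists i j m, g = lie_mnm x_ [<x_ i, x_ j>] m].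

Lemma comm_span_subspace : lin_subspace comm_span.
Proof.
split=> [C [[C0 _] _] //|a x y Sx Sy C CG].
by have [[_ CD] _] := CG; apply: CD; [apply: Sx | apply: Sy].
Qed.

Lemma comm_span_ind (A : set F) : lin_subspace A ->
  (forall i j m, A (lie_mnm x_ [<x_ i, x_ j>] m)) -> comm_span `<=` A.
Proof.
by move=> subA Ax; apply: smallest_sub => // _ [i [j [m ->]]].
Qed.

Lemma comm_span_mnm i j m : comm_span (lie_mnm x_ [<x_ i, x_ j>] m).
Proof. by move=> C [_]; apply; exists i, j, m. Qed.

Let metF := @freeMet_metabelian K n.

Lemma comm_span_derived f : comm_span f -> derived F f.
Proof.
move: f; apply: (comm_span_ind (A := derived F)); first exact: lie_set_subspace.
by move=> i j m; exact: lie_seq_derived (derived_lie _ _).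
Qed.

Lemma comm_span_lie_gen f i : comm_span f -> comm_span [<f, x_ i>].
Proof.
have sD := comm_span_subspace.
suff: comm_span `<=` [set f | comm_span [<f, x_ i>]] by apply.
apply: comm_span_ind.
  split=> [|a g h /= Dg Dh]; first by rewrite /= lie0l; apply: sD.1.
  by rewrite lieDl lieZl; apply: sD.2.
move=> j k m /=; rewrite (lie_mnm_lie metF); last exact: derived_lie.
exact: comm_span_mnm.
Qed.

(** Such sums contain the generators and form a subalgebra: a bracket of two of them falls into
    [comm_span], because [d, e] = 0 and [comm_span] absorbs brackets with generators. *)
Lemma freeMet_decomp f : exists (c : 'rV[K]_n) d,
  comm_span d /\ f = \sum_i c 0 i *: x_ i + d.
Proof.
have sD : subspace comm_span := comm_span_subspace.
pose A : set F := [set f | exists (c : 'rV[K]_n) d,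
  comm_span d /\ f = \sum_i c 0 i *: x_ i + d].
apply: (freeMet_ind (A := A)); last first.
  move=> i; exists (delta_mx 0 i), 0; split; first exact: subspace0 sD.
  rewrite addr0 (bigD1 i) //= mxE !eqxx scale1r big1 ?addr0 // => k ki.
  by rewrite mxE (negPf ki) andbF scale0r.
split; first split=> [|a _ _ [b [d [Dd ->]]] [c [e [De ->]]]].
- exists 0, 0; split; first exact: subspace0 sD.
  by rewrite big1 ?addr0 // => i _; rewrite mxE scale0r.
- exists (a *: b + c), (a *: d + e); split; first exact: sD.2.
  rewrite scalerDr addrACA scaler_sumr -big_split /=; congr (_ + _).
  by apply: eq_bigr => i _; rewrite !mxE scalerDl scalerA.
move=> _ _ [b [d [Dd ->]]] [c [e [De ->]]].
exists 0, [<\sum_i b 0 i *: x_ i + d, \sum_i c 0 i *: x_ i + e>].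
split; last first.
  by rewrite [X in _ = X + _]big1 ?add0r // => i _; rewrite mxE scale0r.
have DL g (a : 'rV[K]_n) : comm_span g -> comm_span [<g, \sum_i a 0 i *: x_ i>].
  move=> Dg; rewrite lie_sumr; apply: (subspace_sum sD) => i _.
  rewrite lieZr; exact: subspaceZ sD _ _ (comm_span_lie_gen _ Dg).
rewrite lieDl !lieDr.
rewrite (lie_derived0 metF (comm_span_derived Dd) (comm_span_derived De)) addr0.
apply: (subspaceD sD _ (DL _ _ Dd)).
apply: (subspaceD sD); last by rewrite lieC; exact: subspaceN sD _ (DL _ _ De).
rewrite lie_suml; apply: (subspace_sum sD) => i _.
rewrite lie_sumr; apply: (subspace_sum sD) => j _.
rewrite lieZl lieZr; do 2 apply: (subspaceZ sD).
rewrite -(lie_mnm0 x_ [<_, _>]); exact: comm_span_mnm.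
Qed.

(** The index k depends only on the product x_i x^m. The truncated [m - U_(k)] is harmless: if x_k
    does not divide x^m, then k = i and the bracket is 0. *)
Definition delta_retract : W -> F := wmod_ext (fun i m =>
  if first_var (U_(i) + m) is Some k then lie_mnm x_ [<x_ i, x_ k>] (m - U_(k))
  else 0).

Lemma delta_retract_is_linear : linear delta_retract.
Proof. exact: wmod_ext_is_linear. Qed.

HB.instance Definition _ := GRing.isLinear.Build K W F *:%R
  delta_retract delta_retract_is_linear.

(** Both terms of the Koszul element lead to the monomial x_i x_j x^m, hence to the same x_k, and
    the Jacobi identity turns [[x_i, x_k], x_j] - [[x_j, x_k], x_i] into [[x_i, x_j], x_k]. *)
Lemma delta_retract_koszul i j m :
  delta_retract (koszul K i j m) = lie_mnm x_ [<x_ i, x_ j>] m.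
Proof.
rewrite koszulE linearB /= /delta_retract !wmod_extX.
have -> : (U_(j) + (U_(i) + m) = U_(i) + (U_(j) + m))%MM.
  by rewrite addmA [(U_(j) + _)%MM]addmC -addmA.
have [k [-> mk]] := first_varU i (U_(j) + m).
have [->|kj] := eqVneq k j.
  by rewrite liexx lie_mnm00 subr0 addmC addmK.
have [->|ki] := eqVneq k i.
  by rewrite liexx lie_mnm00 sub0r -lie_mnmN -lieC [(U_(i) + m)%MM]addmC addmK.
have {}mk : m k != 0%N.
  by move: (mk ki); rewrite mnmDE mnm1E [j == k]eq_sym (negPf kj).
rewrite -!addmBA ?lep1mP // !(lie_mnmU metF); try exact: derived_lie.
rewrite -lie_mnmN -lie_mnmD.
rewrite -[in RHS](submK (m := U_(k)) (m' := m)) ?lep1mP // addmC.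
rewrite (lie_mnmU metF); last exact: derived_lie.
congr (lie_mnm _ _ _).
by rewrite [RHS]lie_derivation [[<x_ i, [<_, _>]>]]lieC.
Qed.

Lemma comm_span_retract d : comm_span d ->
  delta d = inW (delta d).1 /\ delta_retract (delta d).1 = d.
Proof.
suff: comm_span `<=` [set d | delta d = inW (delta d).1 /\
                            delta_retract (delta d).1 = d] by apply.
apply: comm_span_ind => [|i j m /=]; last first.
  by rewrite delta_koszul /= delta_retract_koszul.
split=> [|a f g [f1 f2] [g1 g2]]; first by rewrite /= !linear0.
rewrite /= linearP /=; split.
  by rewrite f1 g1; congr (_, _); rewrite /= scaler0 addr0.
rewrite -[X in delta_retract X]/(a *: (delta f).1 + (delta g).1).
by rewrite linearP /= f2 g2.
Qed.

Lemma comm_span_wsubst d : comm_span d -> wsubst (delta d).1 = 0.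
Proof.
suff: comm_span `<=` [set d | wsubst (delta d).1 = 0] by apply.
apply: comm_span_ind => [|i j m]; last first.
  rewrite /= delta_koszul /= wsubstM linearB /= !wsubst_gen.
  by rewrite [X in _ - X]mulrC subrr mul0r.
split=> [|a f g f1 g1]; first by rewrite /= !linear0.
by rewrite /= !linearP /= f1 g1 scaler0 addr0.
Qed.

Lemma delta_lin (c : 'rV[K]_n) : (delta (\sum_i c 0 i *: x_ i)).2 = c.
Proof.
rewrite linear_sum raddf_sum /= [RHS]row_sum_delta; apply: eq_bigr => i _.
by rewrite linearZ /= delta_gen.
Qed.

Lemma delta_linear_part (c : 'rV[K]_n) d : comm_span d ->
  (delta (\sum_i c 0 i *: x_ i + d)).2 = c.
Proof.
move=> /comm_span_retract[dW _]; rewrite linearD /= delta_lin dW /=.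
by rewrite addr0.
Qed.

(** The V_n-component recovers the linear part, and [delta_retract] recovers the rest. *)
Lemma delta_inj : injective (@delta K n).
Proof.
move=> f g /eqP; rewrite -subr_eq0 -linearB => /eqP d0; apply/eqP.
rewrite -subr_eq0; apply/eqP; move: d0.
have [c [d [Dd ->]]] := freeMet_decomp (f - g).
move=> d0; have c0 : c = 0 by rewrite -(delta_linear_part c Dd) d0.
move: d0; rewrite c0 big1 ?add0r => [|i _]; last by rewrite mxE scale0r.
by move=> d0; have [_ <-] := comm_span_retract Dd; rewrite d0 linear0.
Qed.

Lemma delta_surj w : wsubst w = 0 -> exists f, delta f = inW w.
Proof.
move: w; apply: koszul_exact => [|i j m].
  split=> [|a v w [f fv] [g gw]]; first by exists 0; rewrite linear0.
  exists (a *: f + g); rewrite linearP /= fv gw.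
  by congr (_, _); rewrite /= scaler0 addr0.
by exists (lie_mnm x_ [<x_ i, x_ j>] m); apply: delta_koszul.
Qed.

End FreeMetabelianDelta.

(** * The action of S_n on F_n and on the wreath product *)

Section SymmetricAction.
Variables (K : comNzRingType) (n : nat).
Local Notation W := (wmod K n).
Local Notation F := (freeMet K n).
Implicit Types (w : W) (p : {mpoly K[n]}) (s : 'S_n).

(** The permutation moves the u_i and the x_i at once; the inverse appears because coordinates are
    indexed, not generators. *)
Definition wact s w : W := [ffun i => msym s (w ((s^-1)%g i))].

Definition wreath_act s (y : wreath K n) : wreath K n :=
  (wact s y.1, \row_i y.2 0 ((s^-1)%g i)).

Lemma wact_is_linear s : linear (wact s).
Proof. by move=> a v w; apply/ffunP=> i; rewrite !ffunE msymD msymZ. Qed.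

HB.instance Definition _ s :=
  GRing.isLinear.Build K W W *:%R (wact s) (wact_is_linear s).

Lemma wreath_act_is_linear s : linear (wreath_act s).
Proof.
move=> a v w; rewrite /wreath_act /= linearP; congr (_, _).
by apply/rowP=> i; rewrite !mxE.
Qed.

HB.instance Definition _ s := GRing.isLinear.Build K (wreath K n) (wreath K n)
  *:%R (wreath_act s) (wreath_act_is_linear s).

Lemma msym_var s i : msym s 'X_i = 'X_(s i) :> {mpoly K[n]}.
Proof.
rewrite msymX; congr 'X_[_]; apply/mnmP=> k; rewrite mnmE !mnm1E.
by rewrite -(inj_eq (@perm_inj _ s)) permKV.
Qed.

Lemma wactM s w p : wact s (w *r p) = wact s w *r msym s p.
Proof. by apply/ffunP=> i; rewrite !ffunE msymM. Qed.

Lemma wact_wgen s i : wact s (wgen K i) = wgen K (s i).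
Proof.
apply/ffunP=> k; rewrite !ffunE -(inj_eq (@perm_inj _ s)) permKV.
by case: (k == s i); rewrite ?msym1 ?msym0.
Qed.

Lemma wact_comp s t w : wact t (wact s w) = wact (s * t)%g w.
Proof. by apply/ffunP=> i; rewrite !ffunE msymMm invMg permM. Qed.

Lemma msym_vlin s (b : 'rV[K]_n) :
  msym s (vlin b) = vlin (\row_i b 0 ((s^-1)%g i)).
Proof.
rewrite /vlin raddf_sum /= [RHS](reindex_inj (@perm_inj _ s)) /=.
by apply: eq_bigr => i _; rewrite msymZ msym_var mxE permK.
Qed.

Lemma wreath_act_lie s (y z : wreath K n) :
  wreath_act s [<y, z>] = [<wreath_act s y, wreath_act s z>].
Proof.
rewrite -[RHS]/(_ - _, 0) -[LHS]/(wact s (_ - _), _); congr (_, _).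
  by rewrite linearB /= !wactM !msym_vlin.
by apply/rowP=> i; rewrite !mxE.
Qed.

Lemma sym_act_is_linear s : linear (@sym_act K n s).
Proof. exact: freeMet_lift_linear (@freeMet_metabelian K n). Qed.

HB.instance Definition _ s :=
  GRing.isLinear.Build K F F *:%R (@sym_act K n s) (sym_act_is_linear s).

Lemma sym_act_lie s (f g : F) :
  sym_act s [<f, g>] = [<sym_act s f, sym_act s g>].
Proof. exact: freeMet_lift_lie (@freeMet_metabelian K n) f g. Qed.

Lemma sym_act_gen s i : sym_act s (freeMet_gen K i) = freeMet_gen K (s i).
Proof. exact: freeMet_lift_gen (@freeMet_metabelian K n) i. Qed.

Lemma delta_sym_act s (f : F) : delta (sym_act s f) = wreath_act s (delta f).
Proof.
pose A : set F := [set f | delta (sym_act s f) = wreath_act s (delta f)].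
apply: (freeMet_ind (A := A)) => [|i]; last first.
  rewrite /A /= sym_act_gen !delta_gen /wreath_act /= wact_wgen; congr (_, _).
  by apply/rowP=> k; rewrite !mxE -[_ == i](inj_eq (@perm_inj _ s)) permKV.
split; first split=> [|a g h /= Ag Ah]; first by rewrite /A /= !linear0.
  by rewrite /A /= !linearP /= Ag Ah.
by move=> g h; rewrite /A /= sym_act_lie !delta_lie wreath_act_lie => -> ->.
Qed.

Lemma sym_invariantsP (f : F) :
  sym_invariants K n f <-> forall s, wreath_act s (delta f) = delta f.
Proof.
split=> inv s; first by rewrite -delta_sym_act inv.
by apply: delta_inj; rewrite delta_sym_act.
Qed.

Lemma sym_invariants_subalgebra : lie_subalgebra (sym_invariants K n).
Proof.
split; first split=> [s|a f g fI gI s]; first by rewrite linear0.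
  by rewrite linearP /= fI gI.
by move=> f g fI gI s; rewrite sym_act_lie fI gI.
Qed.

Lemma sum_gen_invariant : sym_invariants K n (\sum_(i < n) freeMet_gen K i).
Proof.
move=> s; rewrite linear_sum /= [RHS](reindex_inj (@perm_inj _ s)) /=.
by apply: eq_bigr => i _; rewrite sym_act_gen.
Qed.

End SymmetricAction.

(** * The elements epsilon_q and their recursion *)

Section Epsilon.
Variables (K : comNzRingType) (n : nat).
Local Notation W := (wmod K n).
Implicit Types (w : W) (p : {mpoly K[n]}) (s : 'S_n) (q : nat).

(** This K[X]-linear map commutes with S_n and, up to sign and modulo symmetric multiples of
    epsilon_1, raises the index of [epsilon] by one. *)
Definition wmulx w : W := [ffun i => w i * 'X_i].

Lemma wmulx_is_linear : linear wmulx.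
Proof.
by move=> a v w; apply/ffunP=> i; rewrite !ffunE mulrDl scalerAl.
Qed.

HB.instance Definition _ :=
  GRing.isLinear.Build K W W *:%R wmulx wmulx_is_linear.

Lemma wmulxM w p : wmulx (w *r p) = wmulx w *r p.
Proof. by apply/ffunP=> i; rewrite !ffunE mulrAC. Qed.

Lemma wact_wmulx s w : wact s (wmulx w) = wmulx (wact s w).
Proof. by apply/ffunP=> i; rewrite !ffunE msymM msym_var permKV. Qed.

Lemma wmulx_wgen i : wmulx (wgen K i) = wgen K i *r 'X_i.
Proof.
by apply/ffunP=> k; rewrite !ffunE; case: eqP => [->|_]; rewrite ?mul0r.
Qed.

Lemma wsubst_sum w : wsubst w = \sum_i wmulx w i.
Proof. by apply: eq_bigr => i _; rewrite ffunE. Qed.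

Lemma epsilonE q i : epsilon K n q i =
  \sum_(J : {set 'I_n} | (#|J| == q.-1) && (i \notin J)) \prod_(j in J) 'X_j.
Proof.
rewrite /epsilon sum_ffunE (bigD1 i) //= wgenE eqxx.
rewrite [X in _ + X]big1 ?addr0 // => k ki.
by rewrite wgenE eq_sym (negPf ki).
Qed.

Lemma epsilon1 : epsilon K n 1 = \sum_i wgen K i.
Proof.
apply/ffunP=> i; rewrite epsilonE (big_pred1 finset.set0) => [|J]; last first.
  by rewrite /= cards_eq0; case: eqP => //= ->; rewrite inE.
rewrite big_set0 sum_ffunE (bigD1 i) //= ffunE eqxx big1 ?addr0 // => k ki.
by rewrite ffunE eq_sym (negPf ki).
Qed.

Lemma epsilon_gt q : (n < q)%N -> epsilon K n q = 0.
Proof.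
move=> lt_nq; apply/ffunP=> i; rewrite epsilonE ffunE big_pred0 // => J.
apply/andP=> -[/eqP cJ iJ]; have := subset_leq_card (finset.subsetT (i |: J)).
by rewrite cardsU1 iJ cJ cardsT card_ord add1n (ltn_predK lt_nq) leqNgt lt_nq.
Qed.

(** Adding i is a bijection from the q-subsets avoiding i onto the (q+1)-subsets containing i. *)
Lemma wmulx_epsilonE q i : wmulx (epsilon K n q.+1) i =
  \sum_(H : {set 'I_n} | (#|H| == q.+1) && (i \in H)) \prod_(j in H) 'X_j.
Proof.
rewrite ffunE epsilonE mulr_suml /=.
rewrite [RHS](reindex_onto (fun J => i |: J) (fun H => H :\ i)) /=; last first.
  by move=> H /andP[_ iH]; rewrite finset.setD1K.
apply: eq_big => [J|J /andP[_ iJ]]; last by rewrite big_setU1 //= mulrC.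
rewrite setU11 andbT cardsU1; case: (boolP (i \in J)) => iJ /=.
  rewrite andbF; apply/esym/negbTE/negP=> /andP[_ /eqP JE].
  by move: iJ; rewrite -JE !inE eqxx.
by rewrite finset.setU1K // eqxx !andbT.
Qed.

(** In coordinate i, the (q+1)-subsets avoiding i are all of them minus those containing i. *)
Lemma epsilonS q :
  epsilon K n q.+2 = epsilon K n 1 *r mesym n K q.+1 - wmulx (epsilon K n q.+1).
Proof.
apply/ffunP=> i; have := wmulx_epsilonE q i; rewrite !ffunE => ->.
have -> : epsilon K n 1 i = 1.
  rewrite epsilon1 sum_ffunE (bigD1 i) //= ffunE eqxx big1 ?addr0 // => k ki.
  by rewrite ffunE eq_sym (negPf ki).
rewrite mul1r /mesym (bigID (fun H : {set 'I_n} => i \in H)) /=.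
by rewrite addrAC subrr add0r epsilonE.
Qed.

Lemma wact_epsilon s q : wact s (epsilon K n q.+1) = epsilon K n q.+1.
Proof.
have e1 : wact s (epsilon K n 1) = epsilon K n 1.
  rewrite epsilon1 linear_sum [RHS](reindex_inj (@perm_inj _ s)) /=.
  by apply: eq_bigr => i _; rewrite wact_wgen.
elim: q => [//|q IHq].
rewrite epsilonS linearB /= wactM wact_wmulx IHq e1.
by rewrite (issymP _ (mesym_sym _ _ _)).
Qed.

(** Each (q+1)-subset is counted once for each of its elements. *)
Lemma wsubst_epsilon q : wsubst (epsilon K n q.+1) = mesym n K q.+1 *+ q.+1.
Proof.
rewrite wsubst_sum (eq_bigr _ (fun i _ => wmulx_epsilonE q i)).
rewrite (exchange_big_dep (fun H : {set 'I_n} => #|H| == q.+1)) /=; last first.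
  by move=> i H _ /andP[].
rewrite /mesym -sumrMnl; apply: eq_bigr => H /eqP cH.
by rewrite cH eqxx /= sumr_const cH.
Qed.

End Epsilon.

(** * Invariants of W_n as a module over the symmetric polynomials *)

Section Invariants.
Variables (K : fieldType) (n : nat).
Hypothesis charK0 : [pchar K] =i pred0.
Local Notation W := (wmod K n).
Implicit Types (w : W) (p : {mpoly K[n]}) (s : 'S_n) (q : nat).

Definition eps_span : set W := [set w | exists c : 'I_n -> {mpoly K[n]},
  (forall i, c i \is symmetric) /\ w = \sum_(i < n) epsilon K n i.+1 *r c i].

Lemma eps_span_subspace : subspace eps_span.
Proof.
split=> [|a _ _ [b [bS ->]] [c [cS ->]]].
  exists (fun=> 0); split=> [i|]; first exact: rpred0.
  by rewrite big1 // => i _; rewrite wmulr0.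
exists (fun i => a *: b i + c i); split=> [i|]; first by rewrite rpredD ?rpredZ.
rewrite scaler_sumr -big_split /=; apply: eq_bigr => i _.
by rewrite wmulrDr wmulrZr.
Qed.

Lemma eps_spanM w p : p \is symmetric -> eps_span w -> eps_span (w *r p).
Proof.
move=> pS [c [cS ->]]; exists (fun i => c i * p); split=> [i|].
  by rewrite rpredM.
by rewrite wmulr_suml; apply: eq_bigr => i _; rewrite wmulrA.
Qed.

(** The case q = n is included since epsilon_(n+1) = 0; there the recursion closes up. *)
Lemma eps_span_eps q : (q <= n)%N -> eps_span (epsilon K n q.+1).
Proof.
rewrite leq_eqVlt => /orP[/eqP->|lt_qn].
  by rewrite epsilon_gt //; apply: subspace0 eps_span_subspace.
exists (fun i => (i == Ordinal lt_qn)%:R); split=> [i|]; first exact: rpred_nat.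
rewrite (bigD1 (Ordinal lt_qn)) //= eqxx wmulr1 big1 ?addr0 // => i /negPf ->.
by rewrite wmulr0.
Qed.

(** The recursion [epsilonS], solved for its [wmulx] term, stays within the span. *)
Lemma eps_span_wmulx w : eps_span w -> eps_span (wmulx w).
Proof.
have sT := eps_span_subspace.
move=> [c [cS ->]]; rewrite linear_sum /=; apply: (subspace_sum sT) => i _.
rewrite wmulxM; apply: eps_spanM => //.
have -> : wmulx (epsilon K n i.+1) =
          epsilon K n 1 *r mesym n K i.+1 - epsilon K n i.+2.
  by rewrite epsilonS opprB addrC subrK.
apply: (subspaceB sT); last exact: eps_span_eps.
apply: eps_spanM; first exact: mesym_sym.
exact: eps_span_eps.
Qed.

Lemma natr_neq0 k : (0 < k)%N -> k%:R != 0 :> K.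
Proof. by move=> k0; have /pcharf0P -> := charK0; rewrite -lt0n. Qed.

Lemma subspace_mulrn (V : lmodType K) (A : set V) (v : V) k :
  subspace A -> (0 < k)%N -> A (v *+ k) -> A v.
Proof.
move=> sA k0 Av; rewrite -[v]scale1r -(mulVf (natr_neq0 k0)) -scalerA.
by rewrite scaler_nat; apply: (subspaceZ sA).
Qed.

(** The factor 1/n! is left out; [subspace_mulrn] divides by n! at the end. *)
Definition symmetrize w : W := \sum_(s : 'S_n) wact s w.

Lemma symmetrize_is_linear : linear symmetrize.
Proof.
move=> a v w; rewrite scaler_sumr -big_split /=.
by apply: eq_bigr => s _; rewrite linearP.
Qed.

HB.instance Definition _ :=
  GRing.isLinear.Build K W W *:%R symmetrize symmetrize_is_linear.

Lemma symmetrize_wact s w : symmetrize (wact s w) = symmetrize w.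
Proof.
rewrite /symmetrize [RHS](reindex_inj (mulgI s)).
by apply: eq_bigr => t _; rewrite wact_comp.
Qed.

Lemma symmetrizeM w p :
  p \is symmetric -> symmetrize (w *r p) = symmetrize w *r p.
Proof.
move=> /issymP pS; rewrite wmulr_suml; apply: eq_bigr => s _.
by rewrite wactM pS.
Qed.

Lemma symmetrize_wmulx w : symmetrize (wmulx w) = wmulx (symmetrize w).
Proof. by rewrite linear_sum; apply: eq_bigr => s _; rewrite wact_wmulx. Qed.

Lemma symmetrize_inv w : (forall s, wact s w = w) -> symmetrize w = w *+ n`!.
Proof.
move=> wS; rewrite /symmetrize (eq_bigr _ (fun s _ => wS s)).
by rewrite sumr_const card_Sn.
Qed.

(** The element u_i x_i^k is a k-fold [wmulx] of u_i, which reduces to k = 0; there all u_i have the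
    same symmetrization, and their sum is epsilon_1. *)
Lemma eps_span_symmetrize_gen i k :
  eps_span (symmetrize (wgen K i *r 'X_i ^+ k)).
Proof.
have -> : wgen K i *r 'X_i ^+ k = iter k (@wmulx K n) (wgen K i).
  elim: k => [|k IHk]; first by rewrite expr0 wmulr1.
  rewrite iterS -IHk wmulxM wmulx_wgen wmulrA -exprS //.
elim: k => [|k IHk]; last first.
  by rewrite iterS symmetrize_wmulx; apply: eps_span_wmulx.
apply: (@subspace_mulrn _ _ _ n eps_span_subspace).
  exact: leq_ltn_trans (ltn_ord i).
have -> : symmetrize (wgen K i) *+ n = symmetrize (epsilon K n 1).
  rewrite epsilon1 linear_sum /=.
  rewrite (eq_bigr (fun=> symmetrize (wgen K i))) => [|j _].
    by rewrite sumr_const card_ord.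
  by rewrite -(symmetrize_wact (tperm i j) (wgen K i)) wact_wgen tpermL.
rewrite symmetrize_inv => [|s]; last exact: wact_epsilon.
rewrite -scaler_nat; apply: (subspaceZ eps_span_subspace).
exact: eps_span_eps.
Qed.

Definition psum a : {mpoly K[n]} := \sum_i 'X_i ^+ a.

Lemma psum_sym a : psum a \is symmetric.
Proof.
apply/issymP=> s; rewrite /psum linear_sum.
rewrite [RHS](reindex_inj (@perm_inj _ s)) /=.
by apply: eq_bigr => i _; rewrite rmorphXn /= msym_var.
Qed.

Definition other_vars (i : 'I_n) (m : 'X_{1..n}) : {set 'I_n} :=
  [set j | (j != i) && (m j != 0%N)]%SET.

(* Induction on the number of variables other than x_i in the monomial x^m,
   splitting off such a variable x_j with its exponent a: multiplying
   symmetrize (u_i x^m') by the power sum of degree a gives a positive multiple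
   of symmetrize (u_i x^m) plus terms with fewer other variables. *)
Lemma eps_span_symmetrize w : eps_span (symmetrize w).
Proof.
have sT := eps_span_subspace.
apply: (wmod_ind (A := [set w | eps_span (symmetrize w)])) => {w}.
  split=> [|a v w /= Tv Tw]; first by rewrite /= linear0; apply: sT.1.
  by rewrite linearP; apply: sT.2.
move=> i m /=; move: {2}#|other_vars i m|.+1 (ltnSn #|other_vars i m|) => k.
elim: k m => // k IHk m; rewrite ltnS => cm.
have [j jm|no_other] := pickP (mem (other_vars i m)); last first.
  suff -> : 'X_[m] = 'X_i ^+ m i :> {mpoly K[n]}.
    exact: eps_span_symmetrize_gen.
  rewrite mpolyXE_id (bigD1 i) //= big1 ?mulr1 // => l li.
  by move: (no_other l); rewrite /= inE li /= => /negbFE/eqP->; rewrite expr0.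
have {jm}[ji mj] : j != i /\ m j != 0%N by move: jm; rewrite /= inE => /andP[].
pose a := m j; pose m' := [multinom if l == j then 0%N else m l | l < n].
have m'E l : m' l = if l == j then 0%N else m l by rewrite mnmE.
have XE : 'X_[m] = 'X_[m'] * 'X_j ^+ a :> {mpoly K[n]}.
  rewrite mpolyXn -mpolyXD; congr 'X_[_]; apply/mnmP=> l.
  rewrite mnmDE mulmnE mnm1E m'E eq_sym; case: eqP => [ <-|_].
    by rewrite mul1n.
  by rewrite mul0n addn0.
have IH (m1 : 'X_{1..n}) : (forall t, t != i -> m1 t != 0%N -> m' t != 0%N) ->
    eps_span (symmetrize (wgen K i *r 'X_[m1])).
  move=> sub1; apply: IHk; apply: leq_trans cm; apply: proper_card.
  apply/properP; split.
    apply/fintype.subsetP=> t; rewrite !inE => /andP[ti /(sub1 _ ti)].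
    by rewrite m'E ti; case: (t == j).
  by exists j; rewrite !inE ji //=; apply/negP=> /(sub1 _ ji); rewrite m'E eqxx.
have := eps_spanM (psum_sym a) (IH m' (fun _ _ => id)).
rewrite -symmetrizeM ?psum_sym // wmulrA mulr_sumr wmulr_sumr linear_sum /=.
(* Split the power sum by whether x_l is new, that is, different from x_i and absent from x^m'. The
   terms that are not new go to [S2] and introduce no further variable. *)
rewrite (bigID (fun l => (l != i) && (m' l == 0%N))) /=.
set S1 := \sum_(_ | _) _; set S2 := \sum_(_ | _) _ => TS.
have TS2 : eps_span S2.
  apply: (subspace_sum sT) => l; rewrite negb_and negbK => m'l.
  rewrite mpolyXn -mpolyXD; apply: IH => t ti.
  rewrite mnmDE mulmnE mnm1E.
  case: (eqVneq l t) => [lt|_]; last by rewrite mul0n addn0.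
  by move: m'l; rewrite lt (negPf ti).
have {TS TS2} : eps_span S1 by rewrite -[S1](addrK S2); apply: (subspaceB sT).
(* Transposing j and l turns x^m' x_j^a into x^m' x_l^a, so all terms of [S1] agree; l = j is among
   them, so their number is positive. *)
rewrite /S1 (eq_bigr (fun=> symmetrize (wgen K i *r 'X_[m]))) => [|l];
  last first.
  case/andP=> li /eqP m'l; rewrite XE -[RHS](symmetrize_wact (tperm j l)).
  rewrite wactM wact_wgen tpermD // msymM rmorphXn /= msym_var tpermL.
  congr (symmetrize (_ *r (_ * _))); rewrite msymX tpermV; congr 'X_[_].
  apply/mnmP=> t; rewrite [RHS]mnmE; case: tpermP => // ->.
    by rewrite m'l m'E eqxx.
  by rewrite m'l m'E eqxx.
rewrite sumr_const; apply: subspace_mulrn => //.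
by apply/card_gt0P; exists j; rewrite unfold_in ji m'E eqxx.
Qed.

Lemma eps_span_inv w : (forall s, wact s w = w) -> eps_span w.
Proof.
move=> wS; apply: (subspace_mulrn eps_span_subspace (fact_gt0 n)).
by rewrite -symmetrize_inv //; apply: eps_span_symmetrize.
Qed.

End Invariants.

(** * Syzygies of the q e_q and the elements h_ij *)

Section Generators.
Variables (K : fieldType) (n : nat).
Hypotheses (charK0 : [pchar K] =i pred0) (n_gt0 : (0 < n)%N).
Local Notation W := (wmod K n).
Local Notation esym := [tuple mesym n K i.+1 | i < n].
Implicit Types (w : W) (p : {mpoly K[n]}) (m : 'X_{1..n}) (q : nat).

(** Since epsilon_q goes to q e_q, the two products cancel. Positivity matters: through the
    truncated predecessor, [epsilon] at 0 coincides with epsilon_1. *)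
Lemma wsubst_hgen q r (a : nat -> nat) : (0 < q)%N -> (0 < r)%N ->
  wsubst (hgen K n q r a) = 0.
Proof.
case: q r => // q [] // r _ _; rewrite wsubstM /hpoly linearB /= !linearMn /=.
rewrite !wsubstM !wsubst_epsilon !(mulrnAl (mesym _ _ _) (mesym _ _ _)).
by rewrite [_ * mesym n K q.+1]mulrC mulNrn mulrnAC subrr mul0r.
Qed.

Lemma wact_hgen s q r (a : nat -> nat) : (0 < q)%N -> (0 < r)%N ->
  wact s (hgen K n q r a) = hgen K n q r a.
Proof.
have eS k : msym s (mesym n K k) = mesym n K k by apply/issymP/mesym_sym.
case: q r => // q [] // r _ _; rewrite wactM /hpoly linearB /= !linearMn /=.
rewrite !mulNrn !wactM !wact_epsilon !eS rmorph_prod; congr (_ *r _).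
by apply: eq_bigr => k _; rewrite rmorphXn /= eS.
Qed.

(** The power of e_1 is split off because [hgen] carries only e_2, ..., e_n; the exponent of e_k
    sits at position k - 1 of the multi-index. *)
Lemma hpoly_prodE q r m :
  hpoly K n q r *r (\prod_(k < n) mesym n K k.+1 ^+ m k) =
  hgen K n q r (fun k => nth 0%N m k.-1) *r (mesym n K 1 ^+ nth 0%N m 0).
Proof.
rewrite /hgen wmulrA mulrC big_add1 -pred_Sn; congr (_ *r _).
rewrite (eq_bigr (fun k : 'I_n => mesym n K k.+1 ^+ nth 0%N m k)) => [|k _].
  rewrite -(big_mkord xpredT (fun k => mesym n K k.+1 ^+ nth 0%N m k)).
  by rewrite big_ltn.
by rewrite (mnm_nth 0%N).
Qed.

(** The reciprocals make [wsubst (koszul_eps w)] equal to [wsubst w] evaluated at e_1, ..., e_n, so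
    syzygies of the variables become syzygies of the q e_q. *)
Definition koszul_eps w : W :=
  \sum_(i < n) epsilon K n i.+1 *r (i.+1%:R^-1 *: (w i \mPo esym)).

Lemma koszul_eps_is_linear : linear koszul_eps.
Proof.
move=> a v w; rewrite /koszul_eps scaler_sumr -big_split /=.
apply: eq_bigr => i _; rewrite !ffunE linearP /= scalerDr wmulrDr.
by rewrite scalerA mulrC -scalerA wmulrZr.
Qed.

HB.instance Definition _ :=
  GRing.isLinear.Build K W W *:%R koszul_eps koszul_eps_is_linear.

Lemma koszul_eps_gen i p : koszul_eps (wgen K i *r p) =
  epsilon K n i.+1 *r (i.+1%:R^-1 *: (p \mPo esym)).
Proof.
rewrite /koszul_eps (bigD1 i) //= wgenE eqxx big1 ?addr0 // => k ki.
by rewrite wgenE (negPf ki) comp_mpoly0 scaler0 wmulr0.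
Qed.

Lemma koszul_eps_koszul (i j : 'I_n) m : koszul_eps (koszul K i j m) =
  (i.+1%:R * j.+1%:R)^-1 *:
    (hpoly K n i.+1 j.+1 *r (\prod_(k < n) mesym n K k.+1 ^+ m k)).
Proof.
have XE k : 'X_[U_(k) + m] \mPo esym =
    mesym n K k.+1 * \prod_(k < n) mesym n K k.+1 ^+ m k.
  rewrite mpolyXD rmorphM /= comp_mpolyXU -tnth_nth tnth_mktuple comp_mpolyX.
  by congr (_ * _); apply: eq_bigr => l _; rewrite tnth_mktuple.
rewrite koszulE linearB /= !koszul_eps_gen !XE !wmulrZr -!wmulrA.
rewrite /hpoly wmulrBl scalerBr -!scaler_nat !wmulrZl !scalerA.
congr (_ - _); congr (_ *: _).
  by rewrite invfM -mulrA mulVf ?mulr1 // natr_neq0.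
by rewrite invfM mulrC mulrA mulfV ?mul1r // natr_neq0.
Qed.

(* A relation sum_q q c_q e_q = 0 with c_q symmetric is, by the fundamental
   theorem on symmetric polynomials, a relation sum_q q d_q X_q = 0 between
   variables, hence a combination of Koszul relations. *)
Lemma invariant_syzygy_span (A : set W) : subspace A ->
  (forall w, A w -> A (w *r mesym n K 1)) ->
  (forall q r a, (1 <= q < r)%N -> (r <= n)%N -> A (hgen K n q r a)) ->
  forall w, (forall s, wact s w = w) -> wsubst w = 0 -> A w.
Proof.
move=> sA Ae Ah w wS w0; have [c [cS wE]] := eps_span_inv charK0 wS.
pose d i := sval (sym_fundamental (cS i)).
have dE i : d i \mPo esym = c i by rewrite /d; case: sym_fundamental => t [].
(* The factor [i.+1] cancels the reciprocal in [koszul_eps]. *)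
pose v : W := [ffun i => d i *+ i.+1].
have v0 : wsubst v = 0.
  (* By algebraic independence, the relation may be tested after substituting e_1, ..., e_n. *)
  apply: (@msym_fundamental_un0 n K); rewrite -[RHS]w0 /wsubst rmorph_sum wE.
  rewrite -/(wsubst _) linear_sum; apply: eq_bigr => i _.
  rewrite /= rmorphM /= comp_mpolyXU -tnth_nth tnth_mktuple ffunE rmorphMn /=.
  by rewrite dE wsubstM wsubst_epsilon !mulrnAl mulrC.
have -> : w = koszul_eps v.
  rewrite wE; apply: eq_bigr => i _; rewrite ffunE rmorphMn /= dE -scaler_nat.
  by rewrite scalerA mulVf ?scale1r // natr_neq0.
have AeX v1 k : A v1 -> A (v1 *r (mesym n K 1 ^+ k)).
  move=> Av; elim: k => [|k IHk]; first by rewrite expr0 wmulr1.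
  by rewrite exprSr -wmulrA; apply: Ae.
have Alt (i j : 'I_n) m : (i < j)%N -> A (koszul_eps (koszul K i j m)).
  move=> ij; rewrite koszul_eps_koszul hpoly_prodE.
  by apply: (subspaceZ sA); apply: AeX; apply: Ah.
apply: (koszul_exact (A := [set v | A (koszul_eps v)])) v0.
  split=> [|a x y /= Ax Ay]; first by rewrite /= linear0; apply: subspace0 sA.
  by rewrite linearP /=; apply: sA.2.
move=> i j m /=; case: (ltngtP i j) => [ij|ji|/val_inj->]; first exact: Alt.
  have -> : koszul K i j m = - koszul K j i m by rewrite !koszulE opprB.
  by rewrite linearN; apply: (subspaceN sA); apply: Alt.
by rewrite koszulE subrr linear0; apply: subspace0 sA.
Qed.

End Generators.

(** * Generators of the algebra of invariants *)

Theorem corollary11 (K : fieldType) (charK0 : [pchar K] =i pred0)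
    (n : nat) (n_ge2 : (2 <= n)%N) :
  (forall (i j : nat) (a : nat -> nat), (1 <= i < j)%N -> (j <= n)%N ->
     exists! g : freeMet K n, delta g = inW (hgen K n i j a)) /\
  sym_invariants K n =
    lie_generated
      ([set \sum_(i < n) freeMet_gen K i] `|`
       [set g : freeMet K n | exists (i j : nat) (a : nat -> nat),
          [/\ (1 <= i < j)%N, (j <= n)%N & delta g = inW (hgen K n i j a)]]).
Proof.
have gen_ex i j a : (1 <= i < j)%N -> exists g, delta g = inW (hgen K n i j a).
  move=> /andP[i0 ij]; apply/delta_surj/wsubst_hgen => //.
  exact: leq_ltn_trans ij.
split=> [i j a ij _|].
  have [g gE] := gen_ex i j a ij; exists g; split=> // h hE.
  by apply: delta_inj; rewrite gE hE.
set S := _ `|` _; apply/seteqP; split; last first.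
  apply: smallest_sub; first exact: sym_invariants_subalgebra.
  move=> g [->|[i [j [a [/andP[i0 ij] _ gE]]]]]; first exact: sum_gen_invariant.
  apply/sym_invariantsP => s; rewrite gE /wreath_act /= wact_hgen //;
    last first.
    exact: leq_ltn_trans ij.
  by congr (_, _); apply/rowP=> k; rewrite !mxE.
have [GL GM] := lie_generated_subalgebra S.
have sG : subspace (lie_generated S) := GL.
have GS g : S g -> lie_generated S g by move=> Sg A [_]; apply.
have Gsum : lie_generated S (\sum_(i < n) freeMet_gen K i) by apply: GS; left.
move=> f fI; have [c [d [Dd fE]]] := freeMet_decomp f.
have n0 : (0 < n)%N by apply: ltnW.
pose i0 := Ordinal n0.
(* Invariance under transpositions forces all linear coefficients to agree. *)
have cE i : c 0 i = c 0 i0.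
  have := (sym_invariantsP f).1 fI (tperm i i0).
  move/(congr1 (fun y : wreath K n => y.2 0 i0)).
  by rewrite /= mxE fE delta_linear_part // tpermV tpermR.
have {}fE : f = c 0 i0 *: \sum_(i < n) freeMet_gen K i + d.
  by rewrite fE scaler_sumr; congr (_ + _); apply: eq_bigr => i _; rewrite cE.
rewrite fE; apply: (subspaceD sG); first exact: subspaceZ sG _ _ Gsum.
have dI : sym_invariants K n d.
  have sI : subspace (sym_invariants K n) := (sym_invariants_subalgebra K n).1.
  rewrite -[d](addKr (c 0 i0 *: \sum_(i < n) freeMet_gen K i)) -fE.
  apply: (subspaceD sI) => //; apply: (subspaceN sI).
  apply: (subspaceZ sI); exact: sum_gen_invariant.
(* It suffices that the image of d lies in [A]: injectivity of [delta] identifies the preimage found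
   there with d. *)
pose A : set (wmod K n) :=
  [set w | exists g, lie_generated S g /\ delta g = inW w].
have [dW _] := comm_span_retract Dd.
suff [g [Gg gE]] : A (delta d).1.
  by rewrite (_ : d = g) //; apply: delta_inj; rewrite dW gE.
apply: (invariant_syzygy_span charK0 n0) => [|w [g [Gg gE]]|i j a ij jn|s|].
- split=> [|a v w [f1 [G1 E1]] [f2 [G2 E2]]].
    by exists 0; rewrite linear0; split=> //; exact: subspace0 sG.
  exists (a *: f1 + f2); split; first exact: sG.2.
  by rewrite linearP /= E1 E2; congr (_, _); rewrite /= scaler0 addr0.
(* Bracketing with f_1 multiplies an element of W_n by x_1 + ... + x_n = e_1. *)
- exists [<g, \sum_(i < n) freeMet_gen K i>]; split; first exact: GM.
  rewrite delta_lie gE lie_inW_wreath; congr (inW (_ *r _)).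
  rewrite linear_sum raddf_sum linear_sum mesym1E; apply: eq_bigr => i _.
  by rewrite /= delta_gen vlin_gen.
- have [g gE] := gen_ex i j a ij; exists g; split=> //; apply: GS; right.
  by exists i, j, a.
- by have /sym_invariantsP/(_ s)/(congr1 fst) := dI.
- exact: comm_span_wsubst.
Qed.
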